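(* Let $K$ be a number field, let $d \geq 2$, and let $\phi \colon \mathbb{P}^1 \to \mathbb{P}^1$ be a polynomial map of degree $d$ defined over $K$. Then $$|\hat{h}_\phi(P) - h(P)| \leq \frac{d}{d-1}\left(\log 2 + \frac{\log d}{d} + h(\phi)\right)$$ for all $P \in \mathbb{P}^1(\overline{K})$.
   Context: Naive height. For a number field $K$, $M_K$ is the set of absolute values on $K$ whose restriction to $\mathbb{Q}$ is one of the standard absolute values $|\cdot|_p$ ($p$ prime, normalized by $|p|_p = p^{-1}$) or $|\cdot|_\infty$ (the usual archimedean one). For $v \in M_K$ lying above $p$ (prime or $\infty$), $n_v = [K_v : \mathbb{Q}_p]$. For $P = (x_0 : \dots : x_N) \in \mathbb{P}^N(K)$ put $H_K(P) = \prod_{v \in M_K} \max\{|x_0|_v, \dots, |x_N|_v\}^{n_v}$. For $P \in \mathbb{P}^N(\overline{\mathbb{Q}})$ put $H(P) = H_K(P)^{1/[K:\mathbb{Q}]}$ for any number field $K$ with $P \in \mathbb{P}^N(K)$ (independent of $K$ and of the homogeneous coordinates), and $h(P) = \log H(P)$, the naive (absolute additive logarithmic) height. Polynomial maps. A rational map $\phi = (f_0 : f_1) \colon \mathbb{P}^1 \to \mathbb{P}^1$ of degree $d \geq 2$ defined over $K$ is given by homogeneous polynomials $f_0, f_1 \in K[X_0, X_1]$ of degree $d$ with no common zero in $\mathbb{P}^1(\overline{K})$. It is called a polynomial map if one can take $f_1(X_0, X_1) = X_1^d$. Height of a map. Writing $f_i(X_0,X_1) = \sum_{j=0}^d a_{ij}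 X_0^{d-j} X_1^j$, the height $h(\phi)$ of $\phi$ is the naive height of the point of projective space whose coordinates are all the coefficients $a_{ij}$ ($i = 0,1$, $0 \le j \le d$). In particular, for a polynomial map with $f_0 = a_0 X_0^d + a_1 X_0^{d-1}X_1 + \dots + a_d X_1^d$ and $f_1 = X_1^d$, $h(\phi) = h((a_0 : \dots : a_d : 1))$. Canonical height. For a rational map $\phi$ of degree $d \geq 2$, $\hat{h}_\phi \colon \mathbb{P}^1(\overline{\mathbb{Q}}) \to \mathbb{R}$ is defined by $\hat{h}_\phi(P) = \lim_{n \to \infty} h(\phi^n(P))/d^n$, where $\phi^n$ is the $n$-th iterate; this limit exists. *)

(* Defs.v *)
From HB Require Import structures.
From mathcomp Require Import all_boot all_order all_algebra all_field.
From mathcomp Require Import all_classical all_reals all_analysis.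
Set Implicit Arguments.
Unset Strict Implicit.
Unset Printing Implicit Defensive.
Import Order.TTheory GRing.Theory Num.Theory.
Import numFieldNormedType.Exports.
Local Open Scope classical_set_scope.
Local Open Scope ring_scope.

(* Number fields are finite extensions K : fieldExtType rat, considered together
   with an embedding iota : K -> algC; algC, the field of complex algebraic
   numbers, plays the role of the algebraic closure of Q (and of K, via iota).
   A point of P^(n-1)(F) is given by homogeneous coordinates, a nonzero row
   vector x : 'rV[F]_n. *)

Section AbsoluteValues.
Variable R : realType.

Definition absolute_value (F : fieldType) (v : F -> R) : Prop :=
  [/\ forall x, 0 <= v x,
      forall x, v x = 0 <-> x = 0,
      forall x y, v (x * y) = v x * v y &
      forall x y, v (x + y) <= v x + v y].

Definition padic_abs (p : nat) (q : rat) : R :=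
  if q == 0 then 0
  else p%:R ^+ logn p `|denq q|%N / p%:R ^+ logn p `|numq q|%N.

Definition standard_abs (w : rat -> R) : Prop :=
  (w = fun q => `|ratr q|) \/ (exists2 p, prime p & w = padic_abs p).

(* M_K *)
Definition places (K : fieldExtType rat) : set (K -> R) :=
  [set v | absolute_value v /\ standard_abs (fun q => v (ratr q))].

Definition abs_dense (K L : fieldType) (w : L -> R) (i : K -> L) : Prop :=
  forall (y : L) (e : R), 0 < e -> exists x : K, w (y - i x) < e.

Definition abs_cauchy (L : fieldType) (w : L -> R) (u : nat -> L) : Prop :=
  forall e : R, 0 < e ->
    exists N, forall m n, (N <= m)%N -> (N <= n)%N -> w (u m - u n) < e.

Definition abs_cvg (L : fieldType) (w : L -> R) (u : nat -> L) (l : L) : Prop :=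
  forall e : R, 0 < e -> exists N, forall n, (N <= n)%N -> w (u n - l) < e.

Definition abs_complete (L : fieldType) (w : L -> R) : Prop :=
  forall u, abs_cauchy w u -> exists l, abs_cvg w u l.

Definition is_completion (K L : fieldType) (v : K -> R) (w : L -> R)
    (i : {rmorphism K -> L}) : Prop :=
  [/\ absolute_value w, forall x, w (i x) = v x,
      abs_dense w i & abs_complete w].

(* Inside the completion K_v, the topological closure of Q is the completion
   Q_p of Q (with Q_p = the real numbers if p is infinite). *)
Definition rat_closure (L : fieldType) (w : L -> R) : set L :=
  [set y | forall e : R, 0 < e -> exists q : rat, w (y - ratr q) < e].

(* For a subfield E of L: [L : E] = n *)
Definition has_degree (L : fieldType) (E : set L) (n : nat) : Prop :=
  exists b : 'I_n -> L, forall y : L, exists! c : 'rV[L]_n,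
    (forall j, E (c 0 j)) /\ y = \sum_(j < n) c 0 j * b j.

(* n_v = [K_v : Q_p] *)
Definition local_degree (K : fieldExtType rat) (v : K -> R) : nat :=
  xget 0%N [set n | exists (L : fieldType) (w : L -> R) (i : {rmorphism K -> L}),
                      is_completion v w i /\ has_degree (rat_closure w) n].

End AbsoluteValues.

Section NaiveHeight.
Variable R : realType.

(* H_K; all but finitely many factors are 1, and the initial value 0 of the
   maximum is harmless because absolute values are nonnegative. *)
Definition mult_height_over (K : fieldExtType rat) (n : nat) (y : 'rV[K]_n) : R :=
  \big[*%R/1]_(v \in @places R K)
    (\big[Num.max/0]_(j < n) v (y 0 j)) ^+ local_degree v.

(* The value H_K(P)^(1/[K:Q]) for some number field K over which P has
   homogeneous coordinates; it depends neither on K nor on the coordinates. *)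
Definition mult_height (n : nat) (x : 'rV[algC]_n) : R :=
  xget 0 [set r | exists (K : fieldExtType rat) (iota : {rmorphism K -> algC})
                         (y : 'rV[K]_n) (c : algC),
                    [/\ c != 0, map_mx iota y = c *: x &
                        r = mult_height_over y `^ (\dim {:K})%:R^-1]].

Definition height (n : nat) (x : 'rV[algC]_n) : R := ln (mult_height x).

End NaiveHeight.

(* The binary form of degree d, sum_j a_j X_0^(d-j) X_1^j, at the point x. *)
Definition form_eval (F : comNzRingType) (d : nat) (a : 'rV[F]_d.+1)
    (x : 'rV[F]_2) : F :=
  \sum_(j < d.+1) a 0 j * x 0 0 ^+ (d - j) * x 0 1 ^+ j.

(* Rational maps (f_0 : f_1) of degree d from P^1 to P^1 defined over K;
   row i of the matrix holds the coefficients of f_i. *)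
Record ratmap (K : fieldExtType rat) (iota : {rmorphism K -> algC}) (d : nat) :=
  Ratmap {
    ratmap_coef : 'M[K]_(2, d.+1);
    ratmap_no_common_zero : forall x : 'rV[algC]_2, x != 0 ->
      exists i, form_eval (map_mx iota (row i ratmap_coef)) x != 0 }.

Section RationalMaps.
Variables (K : fieldExtType rat) (iota : {rmorphism K -> algC}) (d : nat).
Implicit Type phi : ratmap iota d.

(* The pair (f_0, f_1) is determined by the map up to a common nonzero factor. *)
Definition polynomial_map phi : Prop :=
  exists2 c : K, c != 0 & c *: row 1 (ratmap_coef phi) = delta_mx 0 ord_max.

Definition ratmap_eval phi (x : 'rV[algC]_2) : 'rV[algC]_2 :=
  \row_i form_eval (map_mx iota (row i (ratmap_coef phi))) x.

Definition ratmap_height (R : realType) phi : R :=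
  height R (map_mx iota (mxvec (ratmap_coef phi))).

Definition canonical_height (R : realType) phi (x : 'rV[algC]_2) : R :=
  limn (fun n => height R (iter n (ratmap_eval phi) x) / d%:R ^+ n).

End RationalMaps.

(* Main.v *)
(* Let N/Q be a Galois extension containing K, with group G, and for each standard
   absolute value u of Q let w_u be an extension of u to N; one exists because a minimal
   submultiplicative seminorm on N extending u is multiplicative. By weak approximation,
   every place v of K above u is w_u o g for some g in G, and exactly
   [N : K] [K_v : Q_u] elements g give the same v. Hence
   H_K(y)^[N : K] = prod_u prod_g max_k w_u(g y_k), which does not depend on K, and the
   product formula for N follows from that for Q.

   Write phi = (f_0 : b X_1^d), let a_0 be the leading coefficient of f_0, and let C be
   the maximum of the absolute values of all coefficients. At each place,
     max |f_i(x)| <= (d + 1) C max |x_i|^d  and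
     max |x_i|^d <= 2^d (C / |a_0|)^d |b|^-1 max |f_i(x)|,
   without the factors d + 1 and 2^d at finite places. Taking the product over all places
   gives |h(phi(P)) - d h(P)| <= d (log 2 + h(phi)), and a telescoping sum concludes. *)
Require Import Defs.
From HB Require Import structures.
From mathcomp Require Import all_boot all_order all_algebra all_field.
From mathcomp Require Import all_classical all_reals all_analysis.
From mathcomp Require Import ring lra zify.
Set Implicit Arguments.
Unset Strict Implicit.
Unset Printing Implicit Defensive.
Import Order.TTheory GRing.Theory Num.Theory.
Import numFieldNormedType.Exports.
Local Open Scope ring_scope.

(** * Absolute values *)

(** The definitions hide their values: [local_degree] and [mult_height] are picked by [xget] among
    all completions, or all number fields and coordinates, so one value must be shown to exist and
    to be the only one. The product over G settles both. It counts each local degree in group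
    elements, and it gives every candidate height the same expression. The count rests on one
    explicit basis, valid in any completion of K at v: powers of a primitive element, as many as
    this element has conjugates at v. Infinite products are replaced by products over the primes up
    to B. Identities and estimates are stated for all large B, so that finitely many of them combine
    by taking a maximum. The factors d + 1 and 2^d occur at the infinite place only, once for each
    element of G, so dividing by the order of G leaves their bare logarithms. The upper estimate
    takes the symmetric form because d + 1 <= 2^d and h(phi) >= 0. The latter holds because b is one
    of the coefficients and its absolute values have product 1. *)

Section Growth.
Variable R : realType.
Implicit Types a b M e : R.

Lemma bernoulli_ineq a n : 0 <= a -> 1 + a *+ n <= (1 + a) ^+ n.
Proof.
move=> a0; elim: n => [|n IH]; first by rewrite mulr0n addr0 expr0.
rewrite exprS (le_trans _ (ler_wpM2l _ IH)) ?addr_ge0//.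
have : 0 <= a *+ n by rewrite mulrn_wge0.
rewrite mulrS; move: (a *+ n) => c c0; nra.
Qed.

Lemma exprn_unbounded a M : 1 < a -> exists N, forall n, (N <= n)%N -> M < a ^+ n.
Proof.
move=> a1; have b0 : 0 < a - 1 by rewrite subr_gt0.
exists (Num.truncn (`|M| / (a - 1))).+1 => n Nn.
have -> : a = 1 + (a - 1) by rewrite addrC subrK.
apply: lt_le_trans (bernoulli_ineq n (ltW b0)).
have : `|M| / (a - 1) < n%:R.
  apply: lt_le_trans (_ : (Num.truncn (`|M| / (a - 1))).+1%:R <= _).
    by rewrite truncnS_gt.
  by rewrite ler_nat.
rewrite ltr_pdivrMr// mulr_natl => h.
by rewrite (le_lt_trans (ler_norm M))// (lt_trans h)// ltrDr.
Qed.

Lemma exprn_small a e : 0 <= a < 1 -> 0 < e ->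
  exists N, forall n, (N <= n)%N -> a ^+ n < e.
Proof.
move=> /andP[a0 a1] e0; have [->|an0] := eqVneq a 0.
  by exists 1%N => -[//|n] _; rewrite expr0n.
have ap : 0 < a by rewrite lt_neqAle eq_sym an0.
have [N HN] : exists N, forall n, (N <= n)%N -> e^-1 < a^-1 ^+ n.
  by apply: exprn_unbounded; rewrite invf_gt1.
exists N => n /HN; rewrite exprVn ltf_pV2 ?posrE ?exprn_gt0//.
Qed.

Lemma inv_succ_small e : 0 < e -> exists N, forall n, (N <= n)%N -> n.+1%:R^-1 < e.
Proof.
move=> e0; exists (Num.truncn e^-1) => n Nn.
rewrite invf_plt ?posrE//; apply: lt_le_trans (truncnS_gt _) _.
by rewrite ler_nat.
Qed.

(** If [a > 1], put [c = sqrt a > 1] and split [a ^+ n] into two factors [c ^+ n]: by Bernoulli one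
    dominates [n + 1] up to a constant, and the other exceeds any constant. *)
Lemma le1_of_exprn_le_linear a b : 0 <= a ->
  (forall n, a ^+ n <= b * n.+1%:R) -> a <= 1.
Proof.
move=> a0 h; rewrite leNgt; apply/negP => a1.
have b0 : 0 <= b by have := h 0%N; rewrite expr0 mulr1 => /(le_trans ler01).
pose c := Num.sqrt a.
have c1 : 1 < c by rewrite -sqrtr1 ltr_sqrt// (lt_trans ltr01).
have c0 : 0 < c - 1 by rewrite subr_gt0.
have [N HN] := exprn_unbounded (b * (1 + (c - 1)^-1)) c1.
have := h N; apply/negP; rewrite -ltNge.
have -> : a ^+ N = c ^+ N * c ^+ N by rewrite -exprMn -expr2 sqr_sqrtr.
have lin : N.+1%:R <= (1 + (c - 1)^-1) * c ^+ N.
  rewrite mulrDl mul1r -addn1 natrD addrC lerD ?exprn_ege1 ?(ltW c1)//.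
  rewrite mulrC ler_pdivlMr//; have := bernoulli_ineq N (ltW c0).
  by rewrite [1 + (_ - _)]addrC subrK; apply: le_trans; rewrite mulr_natl lerDr.
have cN : 0 < c ^+ N by rewrite exprn_gt0// (lt_trans ltr01).
apply: le_lt_trans (ler_wpM2l b0 lin) _.
by rewrite mulrA ltr_pM2r//; apply: HN.
Qed.
End Growth.

Section AbsoluteValueTheory.
Variables (R : realType) (F : fieldType) (w : F -> R).
Hypothesis hw : absolute_value w.
Implicit Types x y z : F.

Lemma absv_ge0 x : 0 <= w x. Proof. by case: hw. Qed.
Lemma absv_eq0 x : (w x == 0) = (x == 0).
Proof. by case: hw => _ h _ _; apply/eqP/eqP => /h. Qed.
Lemma absv0 : w 0 = 0. Proof. by apply/eqP; rewrite absv_eq0. Qed.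
Lemma absvM x y : w (x * y) = w x * w y. Proof. by case: hw. Qed.
Lemma absvD x y : w (x + y) <= w x + w y. Proof. by case: hw. Qed.
Lemma absv_gt0 x : (0 < w x) = (x != 0).
Proof. by rewrite lt_neqAle absv_ge0 andbT eq_sym absv_eq0. Qed.
Lemma absv1 : w 1 = 1.
Proof.
have w1 : w 1 != 0 by rewrite absv_eq0 oner_eq0.
by apply: (mulfI w1); rewrite -absvM !mulr1.
Qed.
Lemma absvX x n : w (x ^+ n) = w x ^+ n.
Proof. by elim: n => [|n IH]; rewrite ?expr0 ?absv1// !exprS absvM IH. Qed.
Lemma absvV x : w x^-1 = (w x)^-1.
Proof.
have [->|x0] := eqVneq x 0; first by rewrite invr0 absv0 invr0.
have wx : w x != 0 by rewrite absv_eq0.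
by apply: (mulfI wx); rewrite -absvM !mulfV// absv1.
Qed.
Lemma absv_div x y : w (x / y) = w x / w y.
Proof. by rewrite absvM absvV. Qed.
Lemma absvN x : w (- x) = w x.
Proof.
have : w (-1) ^+ 2 = 1 by rewrite -absvX sqrrN expr1n absv1.
move/eqP; rewrite sqrp_eq1 ?absv_ge0// => /eqP h.
by rewrite -mulN1r absvM h mul1r.
Qed.
Lemma absvBC x y : w (x - y) = w (y - x).
Proof. by rewrite -absvN opprB. Qed.
Lemma absvB x y : w (x - y) <= w x + w y.
Proof. by rewrite -(absvN y) absvD. Qed.
Lemma absv_lerB x y : w x - w y <= w (x - y).
Proof. by rewrite lerBlDr (le_trans _ (absvD _ _))// subrK. Qed.
Lemma absv_lerD x y : w x - w y <= w (x + y).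
Proof. by rewrite -(absvN y) -{2}(opprK y) absv_lerB. Qed.
Lemma absv_tri z x y : w (x - y) <= w (x - z) + w (z - y).
Proof. by rewrite (le_trans _ (absvD _ _))// addrA subrK. Qed.
Lemma absv_sum I (r : seq I) (P : pred I) (f : I -> F) :
  w (\sum_(i <- r | P i) f i) <= \sum_(i <- r | P i) w (f i).
Proof.
elim/big_ind2: _ => [|a b c d h1 h2|//]; first by rewrite absv0.
by rewrite (le_trans (absvD _ _))// lerD.
Qed.
Lemma absv_prod I (r : seq I) (P : pred I) (f : I -> F) :
  w (\prod_(i <- r | P i) f i) = \prod_(i <- r | P i) w (f i).
Proof. exact: (big_morph _ absvM absv1). Qed.
(** Binomial coefficients have value at most 1, so the binomial formula bounds [w (x + y) ^+ n] by
    [(n + 1) * m ^+ n]; [le1_of_exprn_le_linear] removes the linear factor. *)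
Lemma absv_ultra x y : (forall n : nat, w n%:R <= 1) ->
  w (x + y) <= Num.max (w x) (w y).
Proof.
move=> wn; set m := Num.max _ _.
have xm : w x <= m by rewrite le_max lexx.
have ym : w y <= m by rewrite le_max lexx orbT.
have m0 : 0 <= m := le_trans (absv_ge0 x) xm.
have [m_eq0|mn0] := eqVneq m 0.
  by rewrite (le_trans (absvD _ _))// m_eq0 -(addr0 0) lerD// -m_eq0.
have mp : 0 < m by rewrite lt_neqAle eq_sym mn0.
rewrite -(mul1r m) -ler_pdivrMr//.
apply: (@le1_of_exprn_le_linear _ _ 1); first by rewrite divr_ge0 ?absv_ge0.
move=> n; rewrite mul1r expr_div_n ler_pdivrMr ?exprn_gt0// -absvX exprDn.
apply: le_trans (absv_sum _ _ _) _.
have -> : n.+1%:R * m ^+ n = \sum_(i < n.+1) m ^+ n.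
  by rewrite sumr_const card_ord mulr_natl.
apply: ler_sum => i _; rewrite -mulr_natr absvM -[leRHS]mulr1.
apply: ler_pM; rewrite ?absv_ge0 ?wn// absvM !absvX.
have le_in : (i <= n)%N by rewrite -ltnS.
have -> : m ^+ n = m ^+ (n - i) * m ^+ i by rewrite -exprD subnK.
by apply: ler_pM; rewrite ?exprn_ge0 ?absv_ge0// lerXn2r ?nnegrE ?absv_ge0.
Qed.

Lemma absv_ultra_sum I (r : seq I) (P : pred I) (f : I -> F) (m : R) :
  (forall n : nat, w n%:R <= 1) -> 0 <= m ->
  (forall i, P i -> w (f i) <= m) -> w (\sum_(i <- r | P i) f i) <= m.
Proof.
move=> wn m0 h; elim/big_ind: _ => [|a b ha hb|//]; first by rewrite absv0.
by rewrite (le_trans (absv_ultra _ _ wn))// ge_max ha.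
Qed.

End AbsoluteValueTheory.

Lemma absv_comp (R : realType) (F L : fieldType) (w : L -> R) (j : {rmorphism F -> L}) :
  absolute_value w -> absolute_value (w \o j).
Proof.
move=> hw; split=> [x|x|x y|x y] /=; first exact: absv_ge0.
- split=> [/eqP|->]; last by rewrite rmorph0 absv0.
  by rewrite absv_eq0// fmorph_eq0 => /eqP.
- by rewrite rmorphM absvM.
- by rewrite rmorphD absvD.
Qed.

(** * Weak approximation *)

Lemma eventually_all (I : eqType) (P : I -> nat -> Prop) (s : seq I) :
  (forall k, k \in s -> exists N, forall n, (N <= n)%N -> P k n) ->
  exists N, forall k, k \in s -> forall n, (N <= n)%N -> P k n.
Proof.
elim: s => [|i s IH] h; first by exists 0%N.
have [N1 h1] := h i (mem_head _ _).
have [k ks|N2 h2] := IH; first by apply: h; rewrite inE ks orbT.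
exists (maxn N1 N2) => k; rewrite inE => /orP[/eqP->|ks] n; rewrite geq_max => /andP[? ?].
  exact: h1.
exact: h2.
Qed.

Section WeakApproximation.
Variables (R : realType) (F : fieldType) (t : F) (tau : R).
Hypothesis tau01 : 0 < tau < 1.
Implicit Types (v w : F -> R) (x y z : F).

(** Powers of [t] scale both values alike. A power of [x] pushes the ratio of the two values beyond
    [tau^-1]; scaling then puts the value at [v] into [[tau, 1)], and the value at [w] exceeds 1. *)
Lemma absv_separate_lt v w x : absolute_value v -> absolute_value w ->
  v t = tau -> w t = tau -> v x < w x -> exists z, v z < 1 < w z.
Proof.
move=> hv hw vt wt vwx; case/andP: tau01 => t0 t1.
have x0 : x != 0 by apply: contraTneq vwx => ->; rewrite !absv0// ltxx.
have vx0 : 0 < v x by rewrite absv_gt0.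
have tn0 : t != 0 by rewrite -(absv_gt0 hv) vt.
have r1 : 1 < w x / v x by rewrite ltr_pdivlMr// mul1r.
have [n /(_ n (leqnn n)) hn] := exprn_unbounded tau^-1 r1.
have a0 : 0 < v x ^+ n by rewrite exprn_gt0.
have [k /(_ k (leqnn k)) hk] : exists N, forall k, (N <= k)%N -> (v x ^+ n)^-1 < tau^-1 ^+ k.
  by apply: exprn_unbounded; rewrite invf_gt1.
set a' := v x ^+ n * tau^-1 ^+ k.
have a'1 : 1 < a' by rewrite /a' -ltr_pdivrMl// mulr1.
have a'0 : 0 < a' := lt_trans ltr01 a'1.
have [m0 /(_ m0 (leqnn _)) hm0] : exists N, forall m, (N <= m)%N -> tau ^+ m < a'^-1.
  by apply: exprn_small; rewrite ?invr_gt0// (ltW t0).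
have exm : exists m, a' * tau ^+ m < 1.
  by exists m0; rewrite mulrC -ltr_pdivlMr// div1r.
case: (ex_minnP exm) => m hm min_m.
(* Since [a' > 1], the least [m] is positive, and its predecessor fails the inequality. *)
have mt : tau <= a' * tau ^+ m.
  case: m hm min_m => [|m] hm min_m; first by move: hm; rewrite expr0 mulr1 ltNge (ltW a'1).
  rewrite exprS mulrCA ler_pMr// leNgt; apply/negP => /min_m.
  by rewrite ltnn.
exists (x ^+ n * t^-1 ^+ k * t ^+ m).
have Ev : v (x ^+ n * t^-1 ^+ k * t ^+ m) = a' * tau ^+ m.
  by rewrite !(absvM hv) !(absvX hv) (absvV hv) vt.
have Ew : w (x ^+ n * t^-1 ^+ k * t ^+ m) = (w x / v x) ^+ n * (a' * tau ^+ m).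
  rewrite !(absvM hw) !(absvX hw) (absvV hw) wt /a' expr_div_n !mulrA.
  by rewrite divfK// gt_eqF.
rewrite Ev Ew hm/=; apply: lt_le_trans (_ : (w x / v x) ^+ n * tau <= _).
  by rewrite -ltr_pdivrMr// div1r.
by rewrite ler_pM2l// exprn_gt0// (lt_trans ltr01).
Qed.

Lemma absv_separate v w : absolute_value v -> absolute_value w ->
  v t = tau -> w t = tau -> v <> w -> exists z, w z < 1 < v z.
Proof.
move=> hv hw vt wt nvw.
have [x nx] : exists x, v x != w x.
  apply: contrapT => h; apply: nvw; apply/funext => x; apply/eqP.
  by apply: contrapT => /negP h'; apply: h; exists x.
move: nx; rewrite neq_lt => /orP[h|h]; last exact: absv_separate_lt h.
have [z /andP[z1 z2]] := absv_separate_lt hv hw vt wt h.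
have z0 : z != 0 by rewrite -(absv_gt0 hw) (lt_trans _ z2).
exists z^-1; rewrite (absvV hv) (absvV hw) invf_lt1 ?absv_gt0// z2.
by rewrite invf_gt1// absv_gt0.
Qed.

Variables (I : eqType) (W : I -> F -> R) (v : F -> R).
Hypothesis hv : absolute_value v.
Hypothesis hW : forall i, absolute_value (W i).
Hypothesis vt : v t = tau.
Hypothesis Wt : forall i, W i t = tau.

(* If [x] is large at [v] and small at the places of [s], and [y] separates [v] from
   a further place [i], then one of [x^n y] and [x^n / (1 + x^n) y] works for large n. *)
Lemma absv_dominate (s : seq I) : (forall i, i \in s -> v <> W i) ->
  exists x, 1 < v x /\ forall i, i \in s -> W i x < 1.
Proof.
elim: s => [|i s IH] hs.
  exists t^-1; split=> //; case/andP: tau01 => t0 t1.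
  by rewrite absvV// vt invf_gt1.
have [k ks|x [vx sx]] := IH; first by apply: hs; rewrite inE ks orbT.
have [y /andP[wy vy]] := absv_separate hv (hW i) vt (Wt i) (hs i (mem_head _ _)).
(* With [X = x ^+ n] and [e = 1] the bound says [W k X * W k y < 1 - W k X], which is what the
   witness [y * (X / (1 + X))] requires at the places of [s]. *)
have small (e : R) : 0 < e -> exists N, forall k, k \in s -> forall n, (N <= n)%N ->
    W k x ^+ n * (W k y + 1) < e.
  move=> e0; apply: (@eventually_all _ (fun k n => _ < e)) => k ks.
  have q0 : 0 < W k y + 1 by rewrite ltr_wpDl// absv_ge0.
  have [||N HN] := @exprn_small _ (W k x) (e / (W k y + 1)).
  - by rewrite absv_ge0//= sx.
  - by rewrite divr_gt0.
  - by exists N => n /HN; rewrite ltr_pdivlMr.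
have [wx|wx] := leP (W i x) 1.
  have [N HN] := small 1 ltr01.
  exists (x ^+ N * y); split.
    by rewrite absvM// absvX// (lt_le_trans vy)// ler_peMl ?absv_ge0// exprn_ege1// ltW.
  move=> k; rewrite inE => /orP[/eqP->|ks]; rewrite absvM// absvX//.
    by apply: le_lt_trans wy; rewrite ler_piMl ?absv_ge0// exprn_ile1// absv_ge0.
  apply: le_lt_trans (HN k ks N (leqnn _)).
  by rewrite ler_wpM2l ?exprn_ge0 ?absv_ge0// lerDl.
have [N1 HN1] := small 1 ltr01.
have vy1 : 0 < v y - 1 by rewrite subr_gt0.
have wy1 : 0 < 1 - W i y by rewrite subr_gt0.
have [N2 HN2] := exprn_unbounded (v y - 1)^-1 vx.
have [N3 HN3] := exprn_unbounded (1 - W i y)^-1 wx.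
have [N4 HN4] := exprn_unbounded 1 vx.
pose n := maxn (maxn N1 N2) (maxn N3 N4).
have {}HN2 := HN2 n ltac:(lia); have {}HN3 := HN3 n ltac:(lia).
have {}HN4 := HN4 n ltac:(lia).
have {}HN1 k ks := HN1 k ks n ltac:(lia).
set X := x ^+ n.
have vX : v X = v x ^+ n by rewrite absvX.
have nz : 1 + X != 0.
  by rewrite -(absv_gt0 hv) addrC (lt_le_trans _ (absv_lerD hv _ _))// absv1// subr_gt0 vX.
exists (y * (X / (1 + X))); split.
  rewrite absvM// absv_div// mulrA ltr_pdivlMr ?absv_gt0// mul1r.
  apply: le_lt_trans (absvD hv _ _) _; rewrite absv1// vX.
  by move: HN2; rewrite -div1r ltr_pdivrMr// mulrBr mulr1 ltrBrDr mulrC.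
move=> k; rewrite inE => /orP[/eqP->|ks].
  rewrite absvM// absv_div// mulrA ltr_pdivrMr ?absv_gt0// mul1r.
  rewrite [1 + X]addrC; apply: lt_le_trans (absv_lerD (hW i) _ _).
  rewrite absv1// /X absvX//.
  by move: HN3; rewrite -div1r ltr_pdivrMr//; lra.
rewrite absvM// absv_div// mulrA ltr_pdivrMr ?absv_gt0// mul1r.
apply: lt_le_trans (absv_lerD (hW k) _ _).
rewrite absv1// /X absvX//; have := HN1 k ks; lra.
Qed.

(** For a high power [X] of a dominating element, [X / (1 + X)] is near 1 where [X] is large and
    near 0 where [X] is small. *)
Lemma absv_weak_approx (s : seq I) (e : R) : (forall i, i \in s -> v <> W i) -> 0 < e ->
  exists x, v (x - 1) < e /\ forall i, i \in s -> W i x < e.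
Proof.
move=> hs e0; have [x [vx sx]] := absv_dominate hs.
have [N1 HN1] : exists N, forall k, k \in s -> forall n, (N <= n)%N ->
    W k x ^+ n < e / (1 + e).
  apply: (@eventually_all _ (fun k n => _ ^+ n < _)) => k ks.
  by apply: exprn_small; rewrite ?absv_ge0 ?sx// divr_gt0// addr_gt0.
have [N2 HN2] := exprn_unbounded (1 + e^-1) vx.
pose n := maxn N1 N2.
have {}HN2 := HN2 n ltac:(lia).
have {}HN1 k ks := HN1 k ks n ltac:(lia).
set X := x ^+ n.
have vX : v X = v x ^+ n by rewrite absvX.
have big : e^-1 < v (1 + X).
  rewrite addrC (lt_le_trans _ (absv_lerD hv _ _))// absv1// vX; lra.
have nz : 1 + X != 0 by rewrite -(absv_gt0 hv) (lt_trans _ big)// invr_gt0.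
exists (X / (1 + X)); split.
  have -> : X / (1 + X) - 1 = - (1 + X)^-1 by field.
  by rewrite absvN// absvV// invf_plt// posrE absv_gt0.
move=> k ks; rewrite absv_div// ltr_pdivrMr ?absv_gt0//.
have := HN1 k ks; rewrite -absvX// -/X ltr_pdivlMr ?addr_gt0// => h.
apply: lt_le_trans (ler_wpM2l (ltW e0) (absv_lerD (hW k) _ _)).
rewrite absv1//; lra.
Qed.

End WeakApproximation.

(** * Extension of absolute values to a finite extension *)

Section RationalScalars.
Variable F : fieldExtType rat.
Implicit Types q r : rat.
Lemma ratr_in_alg q : ratr q = in_alg F q.
Proof. by rewrite -alg_num_field. Qed.
Lemma ext_ratr0 : ratr 0 = 0 :> F. Proof. by rewrite ratr_in_alg rmorph0. Qed.
Lemma ext_ratr1 : ratr 1 = 1 :> F. Proof. by rewrite ratr_in_alg rmorph1. Qed.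
Lemma ext_ratrD q r : ratr (q + r) = ratr q + ratr r :> F.
Proof. by rewrite !ratr_in_alg rmorphD. Qed.
Lemma ext_ratrM q r : ratr (q * r) = ratr q * ratr r :> F.
Proof. by rewrite !ratr_in_alg rmorphM. Qed.
Lemma ext_ratrX q n : ratr (q ^+ n) = ratr q ^+ n :> F.
Proof. by rewrite !ratr_in_alg rmorphXn. Qed.
End RationalScalars.

(** * Submultiplicative seminorms and their minimal elements *)

Section RingSeminorms.
Variables (R : realType) (F : fieldExtType rat) (u : rat -> R).
Hypothesis hu : absolute_value u.
Implicit Types (f g h : F -> R) (x y z : F) (q : rat) (a b : R).

(** Only submultiplicativity is asked for, because it survives infima of chains; multiplicativity is
    recovered from minimality. *)
Definition ring_seminorm f : Prop :=
  [/\ forall x, 0 <= f x,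
      forall x y, f (x + y) <= f x + f y,
      forall x y, f (x * y) <= f x * f y &
      forall q, f (ratr q) = u q].

Lemma ring_seminorm1 f : ring_seminorm f -> f 1 = 1.
Proof. by move=> [_ _ _ h]; rewrite -(absv1 hu) -(ext_ratr1 F). Qed.

Lemma ring_seminorm_gt0 f x : ring_seminorm f -> x != 0 -> 0 < f x.
Proof.
move=> hf x0; have := ring_seminorm1 hf; case: hf => f0 _ fM _.
rewrite -(divff x0) => f1; rewrite lt_neqAle f0 andbT; apply/eqP => fx.
by have := fM x x^-1; rewrite f1 -fx mul0r ler10.
Qed.

(** The family is directed downwards, so a single member approaches the infimum at two points at
    once. Members need be submultiplicative only after passing to another member: this covers the
    quotients [f (z * x ^+ n) / f x ^+ n] below. *)
Lemma inf_ring_seminorm (A : set (F -> R)) :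
  (exists f, A f) ->
  (forall f, A f -> forall x, 0 <= f x) ->
  (forall f, A f -> forall x y, f (x + y) <= f x + f y) ->
  (forall f, A f -> forall q, f (ratr q) = u q) ->
  (forall f g, A f -> A g ->
     exists h, [/\ A h, forall x, h x <= f x & forall x, h x <= g x]) ->
  (forall f, A f -> exists2 h, A h & forall x y, h (x * y) <= f x * f y) ->
  exists2 f, ring_seminorm f & forall g, A g -> forall x, f x <= g x.
Proof.
move=> [f0 Af0] Age0 Aadd Aq Adir Amul.
pose S x := [set f x | f in A]%classic.
have S0 x : (S x !=set0)%classic by exists (f0 x), f0.
have Slb x : has_lbound (S x) by exists 0 => _ [f Af <-]; exact: Age0.
have Shi x : has_inf (S x) by split.
pose m x := inf (S x).
have mle f x : A f -> m x <= f x by move=> Af; apply: ge_inf => //; exists f.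
have madh e x : 0 < e -> exists2 f, A f & f x < m x + e.
  by move=> e0; have [_ [f Af <-] h] := inf_adherent e0 (Shi x); exists f.
have m0 x : 0 <= m x by apply: lb_le_inf => // _ [f Af <-]; exact: Age0.
have both e x y : 0 < e -> exists2 f, A f & f x < m x + e /\ f y < m y + e.
  move=> e0; have [f Af fx] := madh e x e0; have [g Ag gy] := madh e y e0.
  have [h [Ah hf hg]] := Adir f g Af Ag.
  by exists h => //; split; [apply: le_lt_trans fx|apply: le_lt_trans gy].
exists m => [|g Ag x]; last exact: mle.
split=> // [x y|x y|q].
- apply/ler_addgt0Pr => e e0.
  have [f Af [fx fy]] := both (e / 2) x y ltac:(by rewrite divr_gt0).
  have := mle f (x + y) Af; have := Aadd f Af x y; lra.
- apply/ler_addgt0Pr => e e0.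
  (* As [d <= 1], the product [(m x + d) * (m y + d)] exceeds [m x * m y] by at most
     [d * (m x + m y + 1) <= e]. *)
  pose d := Num.min 1 (e / (m x + m y + 1)).
  have s0 : 0 < m x + m y + 1 by rewrite ltr_wpDl// addr_ge0.
  have d0 : 0 < d by rewrite lt_min ltr01 divr_gt0.
  have d1 : d <= 1 by rewrite ge_min lexx.
  have de : d * (m x + m y + 1) <= e.
    by rewrite -ler_pdivlMr// ge_min lexx orbT.
  have [f Af [fx fy]] := both d x y d0.
  have [h Ah hM] := Amul f Af.
  apply: le_trans (mle h _ Ah) (le_trans (hM x y) _).
  apply: le_trans (_ : (m x + d) * (m y + d) <= _).
    by apply: ler_pM; rewrite ?Age0// ltW.
  have := m0 x; have := m0 y; nra.
- apply/eqP; rewrite eq_le; apply/andP; split.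
    by rewrite -(Aq f0 Af0 q) mle.
  by apply: lb_le_inf => // _ [f Af <-]; rewrite Aq.
Qed.

Section SpectralSeminorm.
Variables (g : F -> R) (C : R).
Hypothesis C0 : 0 <= C.
Hypothesis g0 : forall x, 0 <= g x.
Hypothesis gD : forall x y, g (x + y) <= g x + g y.
Hypothesis gM : forall x y, g (x * y) <= C * g x * g y.
Hypothesis gq : forall q, g (ratr q) = u q * g 1.
Hypothesis g1 : 0 < g 1.

(* The spectral seminorm of [x] is the infimum of these [a]; this avoids proving that
   [g (x ^+ k) `^ k^-1] converges. *)
Definition power_bound x a := 0 < a /\ exists M, forall k, g (x ^+ k) <= M * a ^+ k.

Lemma power_bound_norm x e : 0 < e -> power_bound x (C * g x + e).
Proof.
move=> e0; split; first by rewrite ltr_wpDl// mulr_ge0.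
exists (g 1); elim=> [|k IH]; first by rewrite !expr0 mulr1.
rewrite exprS (le_trans (gM _ _))//.
apply: le_trans (ler_wpM2l (mulr_ge0 C0 (g0 x)) IH) _.
rewrite mulrCA ler_wpM2l// exprS ler_wpM2r ?lerDl ?(ltW e0)//.
by rewrite exprn_ge0// addr_ge0 ?mulr_ge0// ltW.
Qed.

Lemma power_boundM x y a b : power_bound x a -> power_bound y b ->
  power_bound (x * y) (a * b).
Proof.
move=> [a0 [M hM]] [b0 [L hL]]; split; first exact: mulr_gt0.
exists (C * M * L) => k; rewrite !exprMn.
apply: le_trans (gM _ _) _; rewrite -!(mulrA C) ler_wpM2l//.
by rewrite mulrACA ler_pM.
Qed.

Lemma seminorm_sum I (r : seq I) (f : I -> F) :
  g (\sum_(i <- r) f i) <= \sum_(i <- r) g (f i).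
Proof.
elim/big_ind2: _ => [|a b c d h1 h2|//].
  by rewrite -(ext_ratr0 F) gq absv0// mul0r.
by rewrite (le_trans (gD _ _))// lerD.
Qed.

Lemma seminormMn x n : g (x *+ n) <= g x *+ n.
Proof.
elim: n => [|n IH].
  by rewrite !mulr0n -(ext_ratr0 F) gq absv0// mul0r.
by rewrite !mulrS (le_trans (gD _ _))// lerD2l.
Qed.

(** Bounding the binomial expansion of [(x + y) ^+ k] term by term gives that of [(a + b) ^+ k], up
    to a constant independent of [k]. *)
Lemma power_boundD x y a b : power_bound x a -> power_bound y b ->
  power_bound (x + y) (a + b).
Proof.
move=> [a0 [M hM]] [b0 [L hL]]; split; first exact: addr_gt0.
exists (C * M * L) => k; rewrite !exprDn mulr_sumr.
apply: le_trans (seminorm_sum _ _) _; apply: ler_sum => i _.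
apply: le_trans (seminormMn _ _) _; rewrite mulrnAr lerMn2r; apply/orP; right.
apply: le_trans (gM _ _) _; rewrite -!(mulrA C) ler_wpM2l//.
by rewrite mulrACA ler_pM.
Qed.

(** Otherwise [(u q / a) ^+ n] would outgrow the constant [M / g 1]. This keeps the infimum from
    dropping below [u] on Q. *)
Lemma power_bound_rat q a : power_bound (ratr q) a -> u q <= a.
Proof.
move=> [a0 [M hM]]; rewrite leNgt; apply/negP => ua.
have r1 : 1 < u q / a by rewrite ltr_pdivlMr// mul1r.
have [n /(_ n (leqnn n))] := exprn_unbounded (M / g 1) r1.
apply/negP; rewrite -leNgt ler_pdivlMr// expr_div_n mulrAC ler_pdivrMr ?exprn_gt0//.
by rewrite -(absvX hu) -gq ext_ratrX.
Qed.

Lemma power_bound_rat_gt q e : 0 < e -> power_bound (ratr q) (u q + e).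
Proof.
move=> e0; split; first by rewrite ltr_wpDl// absv_ge0.
exists (g 1) => k; rewrite -ext_ratrX gq absvX// mulrC ler_wpM2l//.
by rewrite lerXn2r ?nnegrE ?lerDl ?addr_ge0 ?absv_ge0 ?(ltW e0).
Qed.

(** The factor [C] in [gM] and the value [g 1] are absorbed by the constant of [power_bound], so the
    infimum is submultiplicative and extends [u] exactly. *)
Lemma spectral_seminorm_exists : exists2 f, ring_seminorm f &
  (forall x, f x <= C * g x) /\ (forall x a, power_bound x a -> f x <= a).
Proof.
pose S x := [set a | power_bound x a]%classic.
have S0 x : (S x !=set0)%classic by exists (C * g x + 1); exact: power_bound_norm.
have Slb x : has_lbound (S x) by exists 0 => a [/ltW].
have Shi x : has_inf (S x) by split.
pose m x := inf (S x).
have mle x a : power_bound x a -> m x <= a by move=> h; apply: ge_inf.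
have madh e x : 0 < e -> exists2 a, power_bound x a & a < m x + e.
  by move=> e0; have [a Sa h] := inf_adherent e0 (Shi x); exists a.
have m0 x : 0 <= m x by apply: lb_le_inf => // a [/ltW].
exists m; last first.
  split=> // x; apply/ler_addgt0Pr => e e0; apply: mle; exact: power_bound_norm.
split=> // [x y|x y|q].
- apply/ler_addgt0Pr => e e0; have e2 : 0 < e / 2 by rewrite divr_gt0.
  have [a ha a1] := madh _ x e2; have [b hb b1] := madh _ y e2.
  have := mle _ _ (power_boundD ha hb); lra.
- apply/ler_addgt0Pr => e e0.
  pose d := Num.min 1 (e / (m x + m y + 1)).
  have s0 : 0 < m x + m y + 1 by rewrite ltr_wpDl// addr_ge0.
  have d0 : 0 < d by rewrite lt_min ltr01 divr_gt0.
  have d1 : d <= 1 by rewrite ge_min lexx.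
  have de : d * (m x + m y + 1) <= e.
    by rewrite -ler_pdivlMr// ge_min lexx orbT.
  have [a ha a1] := madh _ x d0; have [b hb b1] := madh _ y d0.
  apply: le_trans (mle _ _ (power_boundM ha hb)) _.
  apply: le_trans (_ : (m x + d) * (m y + d) <= _).
    by apply: ler_pM; [case: ha => /ltW|case: hb => /ltW|exact: ltW|exact: ltW].
  have := m0 x; have := m0 y; nra.
- apply/eqP; rewrite eq_le; apply/andP; split.
    by apply/ler_addgt0Pr => e e0; apply: mle; exact: power_bound_rat_gt.
  by apply: lb_le_inf => // a; exact: power_bound_rat.
Qed.

End SpectralSeminorm.

(* A minimal submultiplicative seminorm is multiplicative: it equals its spectral
   seminorm, hence is power-multiplicative, and then [y |-> f (y x^n) / f x ^ n]
   decreases to another seminorm below [f]. *)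
Lemma minimal_seminorm_mul f : ring_seminorm f ->
  (forall h, ring_seminorm h -> (forall x, h x <= f x) -> forall x, f x <= h x) ->
  forall x y, f (x * y) = f x * f y.
Proof.
move=> hf fmin; have f1 := ring_seminorm1 hf; have [f0 fD fM fq] := hf.
have fX x n : f (x ^+ n) = f x ^+ n.
  have fXle k : f (x ^+ k) <= f x ^+ k.
    elim: k => [|k IH]; first by rewrite !expr0 f1.
    by rewrite !exprS (le_trans (fM _ _))// ler_wpM2l.
  case: n => [|n]; first by rewrite !expr0 f1.
  apply/eqP; rewrite eq_le fXle/= leNgt; apply/negP => lt_f.
  (* [b] is the midpoint of [f x] and the root of order [n.+1] of [f (x ^+ n.+1)]. *)
  have [b b0 [bx xb]] : exists2 b, 0 < b & b < f x /\ f (x ^+ n.+1) <= b ^+ n.+1.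
    pose c := f (x ^+ n.+1) `^ n.+1%:R^-1.
    have cX : c ^+ n.+1 = f (x ^+ n.+1).
      by rewrite -powR_mulrn ?powR_ge0// -powRrM mulVf// powRr1.
    have fx0 : 0 < f x.
      rewrite lt_neqAle f0 andbT; apply/eqP => fx.
      by move: lt_f; rewrite -fx expr0n/= ltNge f0.
    have c0 : 0 <= c := powR_ge0 _ _.
    have cx : c < f x.
      rewrite ltNge; apply/negP => h; move: lt_f; rewrite -cX ltNge.
      by rewrite lerXn2r ?nnegrE.
    exists ((c + f x) / 2); first by rewrite divr_gt0// ltr_wpDl.
    split; first lra.
    rewrite -cX lerXn2r ?nnegrE//; lra.
  (* The spectral seminorm lies below [f], and [b] is a power bound of [x], so its value at [x] is
     at most [b < f x], against minimality. *)
  have [|||h hh [hle hpb]] := @spectral_seminorm_exists f 1 ler01 f0 fD.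
  - by move=> y z; rewrite mul1r.
  - by move=> q; rewrite f1 mulr1.
  - by rewrite f1.
  have {hle}hle y : h y <= f y by have := hle y; rewrite mul1r.
  have := fmin h hh hle x; apply/negP; rewrite -ltNge (le_lt_trans _ bx)//.
  apply: hpb; split=> //.
  (* Divide [k] by [n.+1]: full blocks are bounded by powers of [b ^+ n.+1], and the sum dominates
     every remainder. *)
  exists (\sum_(r < n.+1) (f x / b) ^+ r) => k.
  rewrite (divn_eq k n.+1) exprD [b ^+ _]exprD.
  set r := (k %% n.+1)%N; set s := (k %/ n.+1)%N.
  have rn : (r < n.+1)%N by rewrite ltn_mod.
  have e1 : f (x ^+ (s * n.+1)) <= b ^+ (s * n.+1).
    rewrite mulnC !exprM; move: (x ^+ n.+1) (b ^+ n.+1) xb => X B XB.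
    elim: s => [|k' IH]; first by rewrite !expr0 f1.
    by rewrite !exprS (le_trans (fM _ _))// ler_pM.
  have e2 : f (x ^+ r) <= (\sum_(r < n.+1) (f x / b) ^+ r) * b ^+ r.
    apply: le_trans (fXle r) _; rewrite -ler_pdivrMr ?exprn_gt0// -expr_div_n.
    rewrite (bigD1 (Ordinal rn))//= lerDl sumr_ge0// => i _.
    by rewrite exprn_ge0// divr_ge0// ltW.
  by rewrite (le_trans (fM _ _))// [leRHS]mulrCA ler_pM.
move=> x y; apply/eqP; rewrite eq_le fM/=.
have [->|x0] := eqVneq x 0.
  by rewrite mul0r -{1}(ext_ratr0 F) fq absv0// mul0r.
have fx0 := ring_seminorm_gt0 hf x0.
pose s n z := f (z * x ^+ n) / f x ^+ n.
have smono n k z : (n <= k)%N -> s k z <= s n z.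
  move/subnK <-; elim: (k - n)%N => // j; apply: le_trans.
  rewrite /s addSn exprSr mulrA ler_pdivrMr ?exprn_gt0//.
  apply: le_trans (fM _ _) _.
  by rewrite exprSr -[leRHS]mulrA [_^-1 * _]mulrA mulVf ?mul1r// gt_eqF ?exprn_gt0.
have [||||||h hh hle] := @inf_ring_seminorm (range s).
- by exists (s 0%N), 0%N.
- by move=> _ [n _ <-] z; rewrite divr_ge0// exprn_ge0.
- move=> _ [n _ <-] z1 z2; rewrite /s -mulrDl ler_pM2r ?invr_gt0 ?exprn_gt0//.
  by rewrite mulrDl.
- move=> _ [n _ <-] q; rewrite /s.
  have [->|q0] := eqVneq q 0; first by rewrite ext_ratr0 mul0r -(ext_ratr0 F) fq absv0 ?mul0r.
  rewrite -fX; apply/eqP; rewrite eq_le; apply/andP; split.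
    by rewrite ler_pdivrMr ?fX ?exprn_gt0// -fq -fX.
  rewrite ler_pdivlMr ?fX ?exprn_gt0// -fX.
  have := fM (ratr q^-1) (ratr q * x ^+ n).
  rewrite mulrA -ext_ratrM mulVf// ext_ratr1 mul1r fq absvV//.
  by rewrite ler_pdivlMl// absv_gt0.
- move=> _ _ [n _ <-] [k _ <-]; exists (s (maxn n k)); split.
  + by exists (maxn n k).
  + by move=> z; apply: smono; rewrite leq_maxl.
  + by move=> z; apply: smono; rewrite leq_maxr.
(* Doubling the index gives each of the two factors its own [x ^+ n]. *)
- move=> _ [n _ <-]; exists (s (n + n)%N); first by exists (n + n)%N.
  move=> z1 z2; rewrite /s mulf_div -exprD ler_pM2r ?invr_gt0 ?exprn_gt0//.
  by rewrite exprD mulrACA fM.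
have h0 z : h z <= f z.
  apply: le_trans (hle (s 0%N) _ z) _; first by exists 0%N.
  by rewrite /s !expr0 mulr1 divr1.
(* Minimality gives [f y <= h y <= f (y * x) / f x], the missing inequality. *)
have h1 : h y <= s 1%N y by apply: hle; exists 1%N.
have := le_trans (fmin h hh h0 y) h1; rewrite /s !expr1 ler_pdivlMr//.
by rewrite mulrC [y * x]mulrC.
Qed.

(** The sum of the values of the coordinates in a Q-basis is a norm, submultiplicative up to a
    constant [C] read off the products of basis vectors; its spectral seminorm has the required
    properties. *)
Lemma ring_seminorm_exists : exists f, ring_seminorm f.
Proof.
pose b := vbasis {:F}; pose n := \dim {:F}.
pose g x := \sum_(i < n) u (coord b i x).
have g0 x : 0 <= g x by apply: sumr_ge0 => i _; exact: absv_ge0.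
have gD x y : g (x + y) <= g x + g y.
  rewrite -big_split/=; apply: ler_sum => i _; rewrite linearD; exact: absvD.
have gZ q x : g (q *: x) = u q * g x.
  rewrite /g mulr_sumr; apply: eq_bigr => i _; rewrite linearZ/=; exact: absvM.
have gS I (r : seq I) (f : I -> F) : g (\sum_(i <- r) f i) <= \sum_(i <- r) g (f i).
  elim/big_ind2: _ => [|a c d e h1 h2|//].
    by rewrite /g big1// => i _; rewrite linear0; exact: absv0.
  by rewrite (le_trans (gD _ _))// lerD.
pose C := \sum_(i < n) \sum_(j < n) g (b`_i * b`_j).
have C0 : 0 <= C by do 2![apply: sumr_ge0 => ? _].
have gM x y : g (x * y) <= C * g x * g y.
  rewrite {1}(coord_vbasis (memvf x)) {1}(coord_vbasis (memvf y)) mulr_suml.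
  apply: le_trans (gS _ _ _) _.
  apply: le_trans (_ : \sum_(i < n) \sum_(j < n) g (b`_i * b`_j) * g x * g y <= _).
    apply: ler_sum => i _; rewrite mulr_sumr; apply: le_trans (gS _ _ _) _.
    apply: ler_sum => j _; rewrite -scalerAl -scalerAr !gZ mulrA mulrC -mulrA.
    rewrite ler_wpM2l// ler_pM ?absv_ge0//.
      by rewrite /g (bigD1 i)//= lerDl; apply: sumr_ge0 => ? _; exact: absv_ge0.
    by rewrite /g (bigD1 j)//= lerDl; apply: sumr_ge0 => ? _; exact: absv_ge0.
  by rewrite /C !mulr_suml; apply: ler_sum => i _; rewrite !mulr_suml.
have g1 : 0 < g 1.
  rewrite lt_neqAle g0 andbT eq_sym psumr_eq0 => [|i _]; last exact: absv_ge0.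
  apply/negP => /allP h; have := oner_neq0 F.
  rewrite (coord_vbasis (memvf 1)) big1 ?eqxx// => i _.
  by have := h i (mem_index_enum _); rewrite absv_eq0// => /eqP ->; rewrite scale0r.
have gq q : g (ratr q) = u q * g 1 by rewrite -alg_num_field gZ.
by have [f hf _] := spectral_seminorm_exists C0 g0 gD gM gq g1; exists f.
Qed.

Lemma absv_extension : exists w : F -> R,
  absolute_value w /\ forall q, w (ratr q) = u q.
Proof.
pose T := {f | ring_seminorm f}.
(* The order is reversed, so a maximal element is a minimal seminorm. *)
pose le (f g : T) := `[< forall x, sval g x <= sval f x >].
have [||||[f hf] fmin] := @Zorn T le.
- by move=> f; apply/asboolP.
- move=> f g h /asboolP fg /asboolP gh; apply/asboolP => x.
  exact: le_trans (gh x) (fg x).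
- move=> [f hf] [g hg] /asboolP/= fg /asboolP/= gf.
  have E : f = g by apply/funext => x; apply/eqP; rewrite eq_le gf fg.
  by subst g; congr exist; exact: Prop_irrelevance.
(* For the empty chain any seminorm is a bound; otherwise the pointwise infimum is one. *)
- move=> A Atot; have [[f0 Af0]|A0] := pselect (exists f : T, A f); last first.
    have [f hf] := ring_seminorm_exists.
    by exists (exist _ f hf) => s As; case: A0; exists s.
  have [||||||h hh hle] := @inf_ring_seminorm [set sval f | f in A]%classic.
  + by exists (sval f0), f0.
  + by move=> _ [[f []] ? ? ? ? ? <-].
  + by move=> _ [[f []] ? ? ? ? ? <-].
  + by move=> _ [[f []] ? ? ? ? ? <-].
  + move=> _ _ [f Af <-] [g Ag <-].
    have [/asboolP h|/asboolP h] := Atot f g Af Ag.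
      by exists (sval g); split=> //; exists g.
    by exists (sval f); split=> //; exists f.
  + by move=> _ [f Af <-]; exists (sval f); [exists f|case: f {Af} => f []].
  by exists (exist _ h hh) => s As; apply/asboolP => x; apply: hle; exists s.
have fM := minimal_seminorm_mul hf _.
exists f; have [f0 fD _ fq] := hf; split=> //; split=> //.
  move=> x; split=> [fx|->]; last by rewrite -(ext_ratr0 F) fq absv0.
  by apply/eqP; apply: contraTT (eqxx (f x)) => /(ring_seminorm_gt0 hf); rewrite {1}fx ltxx.
apply: fM => h hh hle x.
by have /(congr1 sval)/= -> := fmin (exist _ h hh) (asboolT hle).
Qed.

End RingSeminorms.

(** * Standard absolute values on Q *)

Section StandardAbsoluteValues.
Variable R : realType.
Implicit Types (p : nat) (q r : rat) (a b : int).

(** Cross-multiplication with the reduced fraction: [padic_abs] may be read off any fraction. *)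
Lemma padic_abs_frac p a b : prime p -> a != 0 -> b != 0 ->
  padic_abs R p (a%:Q / b%:Q) = p%:R ^+ logn p `|b|%N / p%:R ^+ logn p `|a|%N.
Proof.
move=> pp a0 b0; have aQ : a%:Q != 0 by rewrite intr_eq0.
have bQ : b%:Q != 0 by rewrite intr_eq0.
set q := a%:Q / b%:Q; have q0 : q != 0 by rewrite mulf_neq0// invr_neq0.
have n0 : numq q != 0 by rewrite numq_eq0.
have d0 : denq q != 0 by rewrite denq_neq0.
have E : numq q * b = a * denq q.
  apply/eqP; rewrite -(eqr_int rat) !rmorphM/= numqE -/q; apply/eqP.
  by rewrite mulrAC /q divfK.
have /(congr1 (logn p)) : (`|numq q| * `|b|)%N = (`|a| * `|denq q|)%N.
  by rewrite -!abszM E.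
rewrite !lognM ?absz_gt0// => EL.
rewrite /padic_abs (negbTE q0).
have pR n : p%:R ^+ n != 0 :> R by rewrite expf_neq0// pnatr_eq0 -lt0n prime_gt0.
by apply/eqP; rewrite eqr_div// -!exprD addnC -EL addnC.
Qed.

Lemma padic_abs_int p a : prime p -> a != 0 ->
  padic_abs R p a%:Q = (p%:R ^+ logn p `|a|%N)^-1.
Proof.
move=> pp a0; have := @padic_abs_frac p a 1 pp a0 isT.
by rewrite divr1 logn1 expr0 div1r.
Qed.

Lemma padic_absM p q r : prime p ->
  padic_abs R p (q * r) = padic_abs R p q * padic_abs R p r.
Proof.
move=> pp; have [->|q0] := eqVneq q 0; first by rewrite mul0r /padic_abs eqxx mul0r.
have [->|r0] := eqVneq r 0; first by rewrite mulr0 /padic_abs eqxx mulr0.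
have nq : numq q != 0 by rewrite numq_eq0.
have nr : numq r != 0 by rewrite numq_eq0.
rewrite -{1}(divq_num_den q) -{1}(divq_num_den r) mulf_div -!rmorphM/=.
rewrite padic_abs_frac ?mulf_neq0 ?denq_neq0// !abszM !lognM ?absz_gt0 ?denq_neq0//.
by rewrite !exprD /padic_abs (negbTE q0) (negbTE r0) mulf_div.
Qed.

Lemma padic_abs_ge0 p q : 0 <= padic_abs R p q.
Proof. by rewrite /padic_abs; case: ifP => // _; rewrite divr_ge0// exprn_ge0. Qed.

Lemma padic_abs_intD p a b : prime p ->
  padic_abs R p (a + b)%:Q <= Num.max (padic_abs R p a%:Q) (padic_abs R p b%:Q).
Proof.
move=> pp; have [->|a0] := eqVneq a 0; first by rewrite add0r le_max lexx orbT.
have [->|b0] := eqVneq b 0; first by rewrite addr0 le_max lexx.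
have [ab0|ab0] := eqVneq (a + b) 0.
  by rewrite ab0 {1}/padic_abs eqxx le_max padic_abs_ge0.
rewrite !padic_abs_int//.
have p1 : 1 <= p%:R :> R by rewrite ler1n prime_gt0.
have pe n : 0 < p%:R ^+ n :> R by rewrite exprn_gt0// (lt_le_trans ltr01).
pose m := minn (logn p `|a|) (logn p `|b|).
have dv c : c != 0 -> (m <= logn p `|c|)%N -> (Posz (p ^ m) %| c)%Z.
  by move=> c0 h; rewrite dvdzE/= pfactor_dvdn ?absz_gt0.
have : (Posz (p ^ m) %| a + b)%Z by rewrite rpredD// dv// /m ?geq_minl ?geq_minr.
rewrite dvdzE/= pfactor_dvdn ?absz_gt0// => h.
apply: le_trans (_ : (p%:R ^+ m)^-1 <= _); first by rewrite lef_pV2 ?posrE// ler_weXn2l.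
by rewrite le_max /m; case: leqP => _; rewrite lexx ?orbT.
Qed.

(** Multiplying by a common denominator [d] reduces to integers, where a common power of [p] divides
    the sum. *)
Lemma padic_absD_max p q r : prime p ->
  padic_abs R p (q + r) <= Num.max (padic_abs R p q) (padic_abs R p r).
Proof.
move=> pp; pose d := (denq q * denq r)%:Q.
have d0 : d != 0 by rewrite intr_eq0 mulf_neq0 ?denq_neq0.
have pd : 0 < padic_abs R p d.
  rewrite /d padic_abs_int ?mulf_neq0 ?denq_neq0// invr_gt0 exprn_gt0//.
  by rewrite ltr0n prime_gt0.
have Eq : d * q = (numq q * denq r)%:Q by rewrite /d !rmorphM/= numqE mulrC mulrA.
have Er : d * r = (numq r * denq q)%:Q.
  by rewrite /d !rmorphM/= numqE -mulrA mulrC [_ * r]mulrC.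
rewrite -(ler_pM2l pd) maxr_pMr ?(ltW pd)// -!padic_absM// mulrDr Eq Er -rmorphD/=.
exact: padic_abs_intD.
Qed.

Lemma padic_absolute_value p : prime p -> absolute_value (padic_abs R p).
Proof.
move=> pp; split=> [x|x|x y|x y]; first exact: padic_abs_ge0.
- split=> [|->]; last by rewrite /padic_abs eqxx.
  rewrite /padic_abs; case: eqP => // _ /eqP.
  rewrite mulf_eq0 invr_eq0 !expf_eq0 pnatr_eq0.
  by case: p pp => // p _; rewrite !andbF.
- exact: padic_absM.
- apply: le_trans (padic_absD_max _ _ pp) _.
  by rewrite ge_max lerDl lerDr !padic_abs_ge0.
Qed.

Lemma standard_absolute_value (u : rat -> R) : standard_abs u -> absolute_value u.
Proof.
case=> [->|[p pp ->]]; last exact: padic_absolute_value.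
split=> [x|x|x y|x y]; first exact: normr_ge0.
- split=> [/eqP|->]; last by rewrite rmorph0 normr0.
  by rewrite normr_eq0 fmorph_eq0 => /eqP.
- by rewrite rmorphM normrM.
- by rewrite rmorphD ler_normD.
Qed.

(** Provides the element of common value in [(0, 1)] on which weak approximation relies. *)
Lemma standard_abs_nontrivial (u : rat -> R) : standard_abs u ->
  exists t, 0 < u t < 1.
Proof.
case=> [->|[p pp ->]].
  exists 2^-1; rewrite fmorphV/= ratr_nat ger0_norm ?invr_ge0//.
  by rewrite invr_gt0 invf_lt1 ?ltr0n// ltr1n.
have p1 := prime_gt1 pp.
have p0 : Posz p != 0 by rewrite eqz_nat -lt0n prime_gt0.
exists (Posz p)%:Q; rewrite padic_abs_int//.
rewrite (logn_prime _ pp) eqxx expr1 invr_gt0 invf_lt1 ?ltr0n ?prime_gt0//.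
by rewrite ltr1n.
Qed.

Lemma padic_abs_le1 p n : prime p -> padic_abs R p n%:R <= 1.
Proof.
move=> pp; have [->|n0] := eqVneq n 0%N; first by rewrite /padic_abs eqxx.
rewrite -[n%:R]/((Posz n)%:Q) padic_abs_int// invf_le1 ?exprn_gt0 ?ltr0n ?prime_gt0//.
by rewrite exprn_ege1// ler1n prime_gt0.
Qed.

Lemma logn_lt p n : (n < p)%N -> logn p n = 0%N.
Proof.
by rewrite lognE; case: (posnP n) => [->|n0] np; rewrite ?andbF// gtnNdvd ?andbF.
Qed.

End StandardAbsoluteValues.

(** * Completions *)

Lemma real_cauchy_cvg (R : realType) (s : nat -> R) :
  (forall e, 0 < e -> exists N, forall m n, (N <= m)%N -> (N <= n)%N -> `|s m - s n| < e) ->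
  cvg (s @ \oo)%classic.
Proof.
move=> hs; apply/cauchy_cvgP/cauchy_exP => e e0; have [N HN] := hs e e0.
exists (s N); exists N => // n /= Nn.
by rewrite -ball_normE/=; apply: HN.
Qed.

Section Completion.
Variables (R : realType) (K : fieldType) (v : K -> R).
Hypothesis hv : absolute_value v.
Implicit Types (u s : nat -> K) (e : R).

(** The proof argument makes [hv] recoverable from the predicate, so that ring structures depending
    on [hv] can be inferred for it. *)
Definition cauchy_pred (_ : absolute_value v) : (nat -> K) -> bool :=
  fun u => `[< abs_cauchy v u >].

Lemma abs_cauchy_bounded u : abs_cauchy v u -> exists2 M, 0 < M & forall n, v (u n) <= M.
Proof.
move=> /(_ 1 ltr01)[N HN].
exists (1 + v (u N) + \sum_(i < N) v (u i)).
  rewrite ltr_wpDr ?ltr_wpDr ?absv_ge0 ?sumr_ge0// => i _; exact: absv_ge0.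
move=> n; have [nN|Nn] := ltnP n N.
  rewrite (bigD1 (Ordinal nN))//=.
  have := absv_ge0 hv (u N).
  have : 0 <= \sum_(i < N | i != Ordinal nN) v (u i).
    by apply: sumr_ge0 => i _; exact: absv_ge0.
  by move: (\sum_(i < N | _) _) => S; lra.
have : 0 <= \sum_(i < N) v (u i) by apply: sumr_ge0 => i _; exact: absv_ge0.
have := HN n N Nn (leqnn _); have := absv_lerB hv (u n) (u N); lra.
Qed.

Lemma cauchy_pred_subring : subring_closed (cauchy_pred hv).
Proof.
split=> [|f g /asboolP hf /asboolP hg|f g /asboolP hf /asboolP hg]; apply/asboolP.
- by move=> e e0; exists 0%N => m n _ _; rewrite subrr absv0.
- move=> e e0; have e2 : 0 < e / 2 by rewrite divr_gt0.
  have [N1 H1] := hf _ e2; have [N2 H2] := hg _ e2.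
  exists (maxn N1 N2) => m n; rewrite !geq_max => /andP[m1 m2] /andP[n1 n2].
  have := H1 m n m1 n1; have := H2 m n m2 n2.
  have := absvB hv (f m - f n) (g m - g n).
  have -> : f m - f n - (g m - g n) = (f - g) m - (f - g) n by rewrite !fctE/=; ring.
  lra.
- have [A A0 HA] := abs_cauchy_bounded hf; have [B B0 HB] := abs_cauchy_bounded hg.
  move=> e e0; have eB : 0 < e / (2 * B) by rewrite divr_gt0// mulr_gt0.
  have eA : 0 < e / (2 * A) by rewrite divr_gt0// mulr_gt0.
  have [N1 H1] := hf _ eB; have [N2 H2] := hg _ eA.
  exists (maxn N1 N2) => m n; rewrite !geq_max => /andP[m1 m2] /andP[n1 n2].
  have h1 := H1 m n m1 n1; have h2 := H2 m n m2 n2.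
  have := absvD hv ((f m - f n) * g m) (f n * (g m - g n)).
  have -> : (f m - f n) * g m + f n * (g m - g n) = (f * g) m - (f * g) n.
    by rewrite !fctE/=; ring.
  rewrite !(absvM hv).
  have : v (f m - f n) * v (g m) < e / 2.
    apply: le_lt_trans (ler_wpM2l (absv_ge0 hv _) (HB m)) _.
    by move: h1; rewrite invfM mulrA ltr_pdivlMr.
  have : v (f n) * v (g m - g n) < e / 2.
    apply: le_lt_trans (ler_wpM2r (absv_ge0 hv _) (HA n)) _.
    by move: h2; rewrite invfM mulrA ltr_pdivlMr// mulrC.
  lra.
Qed.

HB.instance Definition _ :=
  GRing.isSubringClosed.Build (nat -> K) (cauchy_pred hv) cauchy_pred_subring.

Record cauchy_seq := CauchySeq {
  cauchy_val :> nat -> K; cauchy_valP : cauchy_val \in cauchy_pred hv }.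
HB.instance Definition _ := [isSub of cauchy_seq for cauchy_val].
HB.instance Definition _ := [Choice of cauchy_seq by <:].
HB.instance Definition _ := [SubChoice_isSubComNzRing of cauchy_seq by <:].

Definition null_pred : cauchy_seq -> bool :=
  fun f => `[< forall e, 0 < e -> exists N, forall n, (N <= n)%N -> v (f n) < e >].

Lemma null_pred_ideal : idealr_closed null_pred.
Proof.
split.
- by apply/asboolP => e e0; exists 0%N => n _; rewrite /= absv0.
- apply/negP => /asboolP /(_ 1 ltr01)[N /(_ N (leqnn N))].
  by rewrite /= absv1// ltxx.
- move=> a f g /asboolP hf /asboolP hg; apply/asboolP => e e0.
  have [A A0 HA] := abs_cauchy_bounded (asboolW (cauchy_valP a)).
  have eA : 0 < e / (2 * A) by rewrite divr_gt0// mulr_gt0.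
  have [N1 H1] := hf _ eA.
  have e2 : 0 < e / 2 by rewrite divr_gt0.
  have [N2 H2] := hg _ e2.
  exists (maxn N1 N2) => n; rewrite !geq_max => /andP[n1 n2].
  have h1 := H1 n n1; have h2 := H2 n n2.
  rewrite /= fctE/=; have := absvD hv (a n * f n) (g n); rewrite (absvM hv).
  have : v (a n) * v (f n) < e / 2.
    apply: le_lt_trans (ler_wpM2r (absv_ge0 hv _) (HA n)) _.
    by move: h1; rewrite invfM mulrA ltr_pdivlMr// mulrC.
  lra.
Qed.

HB.instance Definition _ := isIdealr.Build cauchy_seq null_pred null_pred_ideal.

Definition null_ideal : idealr cauchy_seq := null_pred.
Definition completion_type := Quotient.quot null_ideal.
HB.instance Definition _ := GRing.ComNzRing.on completion_type.
HB.instance Definition _ := EqQuotient.on completion_type.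

Local Notation Q := completion_type.
Implicit Types (f g : cauchy_seq) (x : K) (y z : Q).

Lemma completion_eqP f g : reflect
  (forall e, 0 < e -> exists N, forall n, (N <= n)%N -> v (f n - g n) < e)
  (\pi_Q f == \pi_Q g)%qT.
Proof.
rewrite -Quotient.idealrBE -[_ \in _]/(null_pred (f - g)).
apply: (iffP (asboolP _)) => h e /h[N HN]; exists N => n /HN.
all: by rewrite /= !fctE.
Qed.

Definition cauchy_cst x : cauchy_seq.
Proof.
exists (fun=> x); apply/asboolP => e e0; exists 0%N => m n _ _.
by rewrite subrr absv0.
Defined.

Definition completion_embed x : Q := (\pi_Q (cauchy_cst x))%qT.

Lemma completion_embed_zmod : zmod_morphism completion_embed.
Proof.
move=> a b; rewrite /completion_embed -rmorphB; congr (\pi_Q _)%qT.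
exact: val_inj.
Qed.
Lemma completion_embed_monoid : monoid_morphism completion_embed.
Proof.
split=> [|a b]; last by rewrite /completion_embed -rmorphM; congr (\pi_Q _)%qT; exact: val_inj.
by rewrite /completion_embed -(rmorph1 (\pi_Q)%qT); congr (\pi_Q _)%qT; exact: val_inj.
Qed.
HB.instance Definition _ :=
  GRing.isZmodMorphism.Build K Q completion_embed completion_embed_zmod.
HB.instance Definition _ :=
  GRing.isMonoidMorphism.Build K Q completion_embed completion_embed_monoid.

Lemma cauchy_seqP f : abs_cauchy v f.
Proof. exact: (asboolW (cauchy_valP f)). Qed.

Lemma absv_dist (a b : K) : `|v a - v b| <= v (a - b).
Proof.
by rewrite ler_norml absv_lerB// andbT lerNl opprB absvBC// absv_lerB.
Qed.

Lemma cauchy_absv_cvg f : cvg ((v \o f) @ \oo)%classic.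
Proof.
apply: real_cauchy_cvg => e /(cauchy_seqP f)[N HN]; exists N => m n mN nN.
by apply: le_lt_trans (HN m n mN nN); exact: absv_dist.
Qed.

Definition completion_abs y : R := limn (v \o (repr y : cauchy_seq)).

Lemma completion_abs_pi f : completion_abs (\pi_Q f)%qT = limn (v \o f).
Proof.
rewrite /completion_abs; set g := repr _.
have /completion_eqP h : (\pi_Q f == \pi_Q g)%qT by rewrite reprK.
apply/cvg_lim => //.
have -> : v \o g = (v \o f) \- (fun n => v (f n) - v (g n)).
  by apply/funext => n /=; rewrite subKr.
have h0 : ((fun n => v (f n) - v (g n)) @ \oo --> 0)%classic.
  apply/cvgrPdist_lt => e /h[N HN]; exists N => // n /= Nn.
  rewrite sub0r normrN; apply: le_lt_trans (HN n Nn); exact: absv_dist.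
have := cvgB (@cauchy_absv_cvg f) h0; rewrite subr0. exact.
Qed.

Lemma completion_abs_near f e : 0 < e ->
  exists N, forall n, (N <= n)%N -> `|v (f n) - completion_abs (\pi_Q f)%qT| < e.
Proof.
move=> e0; rewrite completion_abs_pi.
have /cvgrPdist_lt/(_ e e0)[N _ HN] := @cauchy_absv_cvg f.
by exists N => n Nn; rewrite distrC; exact: HN.
Qed.

Lemma completion_abs_embed x : completion_abs (completion_embed x) = v x.
Proof.
rewrite completion_abs_pi (_ : _ \o _ = cst (v x))//; exact: lim_cst.
Qed.

Lemma completion_abs_le f M : (exists N, forall n, (N <= n)%N -> v (f n) <= M) ->
  completion_abs (\pi_Q f)%qT <= M.
Proof.
move=> [N HN]; rewrite completion_abs_pi; apply: limr_le; first exact: cauchy_absv_cvg.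
by exists N.
Qed.

Lemma completion_piP y : exists f, y = (\pi_Q f)%qT.
Proof. by exists (repr y); rewrite reprK. Qed.

Lemma completion_abs_ge0 y : 0 <= completion_abs y.
Proof.
have [f ->] := completion_piP y; rewrite completion_abs_pi.
apply: limr_ge; first exact: cauchy_absv_cvg.
by exists 0%N => // n _; exact: absv_ge0.
Qed.

Lemma completion_abs_eq0 y : completion_abs y = 0 <-> y = 0.
Proof.
have [f ->] := completion_piP y; split=> [h|->]; last first.
  by rewrite -(rmorph0 completion_embed) completion_abs_embed absv0.
apply/eqP; rewrite -(rmorph0 completion_embed); apply/completion_eqP => e e0.
have [N HN] := completion_abs_near f e0; exists N => n /HN.
by rewrite h subr0 ger0_norm ?absv_ge0//= subr0.
Qed.

Lemma completion_absM y z : completion_abs (y * z) = completion_abs y * completion_abs z.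
Proof.
have [f ->] := completion_piP y; have [g ->] := completion_piP z.
rewrite -rmorphM !completion_abs_pi -limM; [|exact: cauchy_absv_cvg|exact: cauchy_absv_cvg].
by congr (limn _); apply/funext => n /=; rewrite fctE/= absvM.
Qed.

Lemma completion_absD y z : completion_abs (y + z) <= completion_abs y + completion_abs z.
Proof.
have [f ->] := completion_piP y; have [g ->] := completion_piP z.
have := @cauchy_absv_cvg (f + g).
rewrite -rmorphD !completion_abs_pi -limD; [|exact: cauchy_absv_cvg|exact: cauchy_absv_cvg].
move=> h; apply: ler_lim => //; first by apply: is_cvgD; exact: cauchy_absv_cvg.
by exists 0%N => // n _ /=; rewrite fctE/= absvD.
Qed.

(** A sequence of nonzero class is eventually bounded away from 0, by half of its limit value, so
    its termwise inverse is Cauchy. *)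
Lemma completion_inv_exists y : y != 0 -> exists z, z * y = 1.
Proof.
have [f ->] := completion_piP y => y0.
set l := completion_abs (\pi_Q f)%qT.
have l0 : 0 < l.
  rewrite lt_neqAle completion_abs_ge0 andbT eq_sym; apply: contraNneq y0.
  by move/completion_abs_eq0 ->.
have l2 : 0 < l / 2 by rewrite divr_gt0.
have [N HN] := completion_abs_near f l2.
have big n : (N <= n)%N -> l / 2 < v (f n).
  by move=> /HN; rewrite ltr_norml -/l => /andP[]; lra.
have nz n : (N <= n)%N -> f n != 0.
  by move=> /big h; rewrite -(absv_gt0 hv) (lt_trans _ h).
(* Terms before [N] may vanish; their inverse is then 0, which does not affect the class. *)
have cg : (fun n => (f n)^-1) \in cauchy_pred hv.
  apply/asboolP => e e0.
  have d0 : 0 < e * ((l / 2) * (l / 2)) by rewrite !mulr_gt0.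
  have [N' HN'] := cauchy_seqP f d0.
  exists (maxn N N') => m n; rewrite !geq_max => /andP[m1 m2] /andP[n1 n2].
  have -> : (f m)^-1 - (f n)^-1 = (f n - f m) / (f m * f n).
    by field; rewrite ?nz.
  rewrite (absv_div hv) ltr_pdivrMr ?absv_gt0 ?mulf_neq0 ?nz//.
  apply: lt_le_trans (HN' n m n2 m2) _; rewrite ler_pM2l// (absvM hv).
  by rewrite ler_pM ?(ltW l2) ?(ltW (big _ _)).
exists (\pi_Q (CauchySeq cg))%qT; apply/eqP; rewrite -rmorphM -(rmorph1 completion_embed).
apply/completion_eqP => e e0; exists N => n Nn.
by rewrite /= fctE/= mulVf ?nz// subrr absv0.
Qed.

Definition completion_inv y : Q :=
  if pselect (y != 0) is left h then projT1 (cid (completion_inv_exists h)) else 0.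

Lemma completion_mulVf y : y != 0 -> completion_inv y * y = 1.
Proof.
by move=> y0; rewrite /completion_inv; case: pselect => // h; case: cid.
Qed.
Lemma completion_inv0 : completion_inv 0 = 0.
Proof. by rewrite /completion_inv; case: pselect => // h; exfalso; rewrite eqxx in h. Qed.
HB.instance Definition _ :=
  GRing.ComNzRing_isField.Build Q completion_mulVf completion_inv0.

Lemma completion_absolute_value : absolute_value (completion_abs : (Q : fieldType) -> R).
Proof.
split; [exact: completion_abs_ge0|exact: completion_abs_eq0|exact: completion_absM|].
exact: completion_absD.
Qed.

Lemma completion_dense y e : 0 < e -> exists x, completion_abs (y - completion_embed x) < e.
Proof.
have [f ->] := completion_piP y => e0; have e2 : 0 < e / 2 by rewrite divr_gt0.
have [N HN] := cauchy_seqP f e2; exists (f N).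
apply: le_lt_trans (_ : e / 2 < e); last lra.
rewrite /completion_embed -rmorphB; apply: completion_abs_le; exists N => n Nn.
by rewrite /= !fctE/= ltW// HN.
Qed.

(** Replace the k-th term by an element of K at distance less than [1 / (k + 1)]: these form a
    Cauchy sequence in K, whose class is the limit. *)
Lemma completion_complete : abs_complete (completion_abs : (Q : fieldType) -> R).
Proof.
move=> s hs.
have h k : exists x, completion_abs (s k - completion_embed x) < k.+1%:R^-1.
  by apply: completion_dense; rewrite invr_gt0.
pose x k := projT1 (cid (h k)).
have hx k : completion_abs (s k - completion_embed (x k)) < k.+1%:R^-1.
  by rewrite /x; case: cid.
have small := @inv_succ_small R.
have hv' := completion_absolute_value.
have cx : abs_cauchy v x.
  move=> e e0; have e3 : 0 < e / 3 by rewrite divr_gt0.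
  have [N1 H1] := hs _ e3; have [N2 H2] := small _ e3.
  exists (maxn N1 N2) => m n; rewrite !geq_max => /andP[m1 m2] /andP[n1 n2].
  rewrite -completion_abs_embed rmorphB/=.
  have := absv_tri hv' (s m) (completion_embed (x m)) (completion_embed (x n)).
  have := absv_tri hv' (s n) (s m) (completion_embed (x n)).
  rewrite (absvBC hv' (completion_embed (x m)) (s m)).
  have := H1 m n m1 n1.
  have := lt_trans (hx m) (H2 m m2); have := lt_trans (hx n) (H2 n n2); lra.
pose l := CauchySeq (asboolT cx : x \in cauchy_pred hv).
exists (\pi_Q l)%qT => e e0; have e3 : 0 < e / 3 by rewrite divr_gt0.
have [N1 H1] := cx _ e3; have [N2 H2] := small _ e3.
exists (maxn N1 N2) => n; rewrite geq_max => /andP[n1 n2].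
have := absv_tri hv' (completion_embed (x n)) (s n) (\pi_Q l)%qT.
have : completion_abs (completion_embed (x n) - (\pi_Q l)%qT) <= e / 3.
  rewrite /completion_embed -rmorphB; apply: completion_abs_le; exists N1 => k Nk.
  by rewrite /= !fctE/= ltW// H1.
have := lt_trans (hx n) (H2 n n2); lra.
Qed.

End Completion.

Lemma completion_exists (R : realType) (K : fieldType) (v : K -> R) :
  absolute_value v ->
  exists (L : fieldType) (w : L -> R) (i : {rmorphism K -> L}), is_completion v w i.
Proof.
move=> hv; exists (completion_type hv), (@completion_abs _ _ _ hv), (completion_embed hv).
split; first exact: completion_absolute_value.
- exact: completion_abs_embed.
- exact: completion_dense.
- exact: completion_complete.
Qed.

(** * Places of a number field *)

Lemma rat_ext_separable (L : fieldExtType rat) : separable 1 {:L}.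
Proof.
apply/separableP => y _; apply: pcharf0_separable => p; apply/negP => /andP[pp].
by rewrite -(rmorph_nat (in_alg L)) fmorph_eq0 pnatr_eq0 => /eqP p0; rewrite p0 in pp.
Qed.

(** * Galois invariants, traces and characteristic polynomials over Q *)

Section GaloisOverQ.
Variable N : splittingFieldType rat.
Local Notation G := (gal_of {:N}%VS).
Implicit Types (g h : G) (a b c : N).

Lemma galQ_mem g : g \in 'Gal({:N} / 1)%g.
Proof. by rewrite gal_kHom ?sub1v// k1AHom. Qed.

Lemma galQ_galois : galois 1 {:N}%VS.
Proof.
by rewrite /galois sub1v normalFieldf rat_ext_separable.
Qed.

Lemma galQM g h a : (g * h)%g a = h (g a).
Proof. by rewrite galM// memvf. Qed.

Lemma galQ_fixed a : (forall g, g a = a) -> exists q, a = ratr q.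
Proof.
move=> ha; have : a \in (1%AS : {vspace N}).
  rewrite -(galois_fixedField galQ_galois).
  by apply/fixedFieldP; [exact: memvf|move=> x _; exact: ha].
by move=> /vlineP[q ->]; exists q; rewrite alg_num_field.
Qed.

Lemma galQ_card : #|{: G}| = \dim {:N}.
Proof.
have := galois_dim galQ_galois; rewrite dimv1 divn1 => ->.
by apply: eq_card => g; rewrite galQ_mem inE.
Qed.

Lemma galQ_ratr g q : g (ratr q) = ratr q.
Proof. by rewrite -alg_num_field rmorph_alg. Qed.

Lemma galQ_trace a : exists q, \sum_(g : G) g a = ratr q.
Proof.
apply: galQ_fixed => h; rewrite rmorph_sum/=.
rewrite [RHS](reindex_inj (mulIg h))/=; apply: eq_bigr => g _.
by rewrite galQM.
Qed.

(** The characteristic polynomial of [a] over Q: conjugates are repeated when [a] does not generate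
    N. *)
Definition galQ_poly a : {poly N} := \prod_(g : G) ('X - (g a)%:P).

Lemma galQ_polyE a : exists p : {poly rat}, galQ_poly a = map_poly (in_alg N) p.
Proof.
have fix_coef i : exists q, (galQ_poly a)`_i = ratr q.
  apply: galQ_fixed => h; rewrite -[LHS](coef_map h) /galQ_poly rmorph_prod/=.
  congr ((polyseq _)`_i).
  rewrite [RHS](reindex_inj (mulIg h))/=; apply: eq_bigr => g _.
  by rewrite rmorphB/= map_polyX map_polyC/= galQM.
pose f i := projT1 (cid (fix_coef i)).
have hf i : (galQ_poly a)`_i = ratr (f i) by rewrite /f; case: cid.
exists (\poly_(i < size (galQ_poly a)) f i); apply/polyP => i.
rewrite coef_map coef_poly; case: ltnP => h; last by rewrite /= scale0r nth_default.
by rewrite hf ratr_in_alg.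
Qed.

End GaloisOverQ.

(** Every coefficient but the leading one is a sum of products, each with at least one root as a
    factor; [2 ^+ size s] bounds the number of terms. The weaker bound, valid also for the leading
    coefficient, carries the induction. *)
Lemma absv_coef_prod_root (R : realType) (F : fieldType) (w : F -> R) (s : seq F) (e : R) :
  absolute_value w -> 0 <= e <= 1 -> (forall a, a \in s -> w a <= e) ->
  forall i, w (\prod_(a <- s) ('X - a%:P))`_i <= 2 ^+ size s /\
    ((i < size s)%N -> w (\prod_(a <- s) ('X - a%:P))`_i <= e * 2 ^+ size s).
Proof.
move=> hw /andP[e0 e1]; elim: s => [|a s IH] hs i.
  rewrite big_nil coef1 expr0; split=> //.
  by case: eqP => _; rewrite ?(absv0 hw) ?(absv1 hw).
have {}IH : forall i, w (\prod_(b <- s) ('X - b%:P))`_i <= 2 ^+ size s /\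
    ((i < size s)%N -> w (\prod_(b <- s) ('X - b%:P))`_i <= e * 2 ^+ size s).
  by apply: IH => b bs; apply: hs; rewrite inE bs orbT.
have wa := hs a (mem_head _ _).
set P := \prod_(b <- s) _ in IH; rewrite big_cons -/P mulrBl coefB coefXM coefCM.
have two : 0 < 2 ^+ size s :> R by rewrite exprn_gt0.
set c := (if _ then _ else _).
have hc : w c <= 2 ^+ size s.
  by rewrite /c; case: eqP => _; rewrite ?(absv0 hw) ?(ltW two)//; case: (IH i.-1).
have hM : w (a * P`_i) <= e * 2 ^+ size s.
  by rewrite (absvM hw) ler_pM ?absv_ge0//; case: (IH i).
have := absvB hw c (a * P`_i).
have le1 : e * 2 ^+ size s <= 2 ^+ size s by rewrite ler_piMl// ltW.
rewrite /= exprS; split; first by lra.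
move=> i_lt; suff : w c <= e * 2 ^+ size s by lra.
rewrite /c; case: eqP => [_|/eqP i0]; first by rewrite (absv0 hw) mulr_ge0// ltW.
by apply: (IH i.-1).2; rewrite -ltnS prednK ?lt0n.
Qed.

Section PlacesAbove.
Variables (R : realType) (N : splittingFieldType rat) (u : rat -> R) (w : N -> R).
Local Notation G := (gal_of {:N}%VS).
Hypothesis hu : standard_abs u.
Hypothesis hw : absolute_value w.
Hypothesis wu : forall q, w (ratr q) = u q.

Lemma absv_galQ (g : G) : absolute_value (fun x => w (g x)).
Proof. exact: (absv_comp (gal_repr g)). Qed.

(* If [v] differed from all [w \o g \o j], weak approximation would give [x] close to
   1 at [v] with all [w (g (j x))] tiny; then the characteristic polynomial of [x] has
   tiny rational coefficients below the leading one, contradicting [v x ~ 1]. *)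
Lemma place_above (K : fieldExtType rat) (j : {rmorphism K -> N}) (v : K -> R) :
  absolute_value v -> (forall q, v (ratr q) = u q) ->
  exists g : G, v = fun x => w (g (j x)).
Proof.
move=> hv vu; apply: contrapT => hno.
have [t ht] := standard_abs_nontrivial hu.
have [n En] : exists n, n = size (enum {: G}) by eexists.
have n0 : (0 < n)%N by rewrite En -cardE; apply/card_gt0P; exists 1%g.
pose W (g : G) x := w (g (j x)).
have hW g : absolute_value (W g) by exact: (absv_comp j (absv_galQ g)).
have Wt g : W g (ratr t) = u t by rewrite /W fmorph_rat galQ_ratr wu.
(* The coefficients will be at most [e * 2 ^+ n] and [v x <= 2], so the lower terms sum to at most
   [e * M]. The choice of [e] makes this less than [2^-1 ^+ n <= v x ^+ n]. *)
pose M : R := \sum_(i < n) 2 ^+ n * 2 ^+ i.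
have M0 : 0 <= M by apply: sumr_ge0 => i _; rewrite mulr_ge0// exprn_ge0.
pose e := Num.min 2^-1 (2^-1 ^+ n / (M + 1)).
have e0 : 0 < e by rewrite lt_min invr_gt0 ltr0n/= divr_gt0 ?exprn_gt0 ?ltr_wpDl.
have e1 : e <= 2^-1 by rewrite ge_min lexx.
have eM : e * M < 2^-1 ^+ n.
  have : e * (M + 1) <= 2^-1 ^+ n by rewrite -ler_pdivlMr ?ltr_wpDl// ge_min lexx orbT.
  by rewrite mulrDr mulr1; apply: lt_le_trans; rewrite ltrDl.
have [|x [vx Wx]] := @absv_weak_approx _ _ _ _ ht _ W v hv hW (vu t) Wt (enum {: G}) e _ e0.
  by move=> g _ hvw; apply: hno; exists g; rewrite hvw.
have [p hp] := galQ_polyE (j x).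
have big_enumE : galQ_poly (j x) = \prod_(a <- [seq g (j x) | g : G <- enum {: G}]) ('X - a%:P).
  by rewrite big_map big_enum.
have bound i : (i < n)%N -> u p`_i <= e * 2 ^+ n.
  move=> i_n; rewrite -wu ratr_in_alg -(coef_map (in_alg N)) -hp big_enumE.
  have [||_] := @absv_coef_prod_root _ _ w [seq g (j x) | g : G <- enum {: G}] e hw _ _ i.
  - by rewrite (ltW e0)/= (le_trans e1)// invf_le1 ?ler1n.
  - by move=> _ /mapP[g _ ->]; rewrite ltW//; apply: Wx; rewrite mem_enum.
  - by rewrite size_map -En; apply.
have size_p : size p = n.+1.
  by rewrite -(size_map_poly (in_alg N)) -hp big_enumE size_prod_XsubC size_map En.
have lead_p : p`_n = 1.
  apply: (fmorph_inj (in_alg N)); rewrite rmorph1 -coef_map -hp.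
  have := monic_prod_XsubC [seq g (j x) | g : G <- enum {: G}] xpredT id.
  by rewrite -big_enumE monicE lead_coefE hp size_map_poly size_p => /eqP.
have root_p : (map_poly (in_alg K) p).[x] = 0.
  apply: (fmorph_inj j); rewrite rmorph0 -horner_map -map_poly_comp.
  rewrite (@eq_map_poly _ _ _ (in_alg N)) => [|q]; last first.
    by rewrite /= !alg_num_field fmorph_rat.
  rewrite -hp /galQ_poly horner_prod (bigD1 (1%g : G))//= gal_id.
  by rewrite hornerXsubC subrr mul0r.
have vx2 : 2^-1 <= v x <= 2.
  have := absv_lerB hv 1 (1 - x); have := absvD hv 1 (x - 1).
  rewrite (absvBC hv 1 x) subKr addrC subrK (absv1 hv); lra.
have : v (x ^+ n) <= e * M.
  move: root_p; rewrite horner_coef size_map_poly size_p big_ord_recr/=.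
  rewrite coef_map/= lead_p scale1r mul1r => /eqP; rewrite addrC addr_eq0 => /eqP ->.
  rewrite (absvN hv) mulr_sumr; apply: le_trans (absv_sum hv _ _ _) _.
  apply: ler_sum => i _; rewrite coef_map/= alg_num_field (absvM hv) vu (absvX hv) mulrA.
  case/andP: vx2 => vx1 vx2; apply: ler_pM.
  - exact: (absv_ge0 (standard_absolute_value hu)).
  - by rewrite exprn_ge0// absv_ge0.
  - exact: bound (ltn_ord i).
  - by rewrite lerXn2r ?nnegrE ?(absv_ge0 hv).
apply/negP; rewrite -ltNge (lt_le_trans eM)// (absvX hv) lerXn2r ?nnegrE ?(absv_ge0 hv) ?invr_ge0//.
by case/andP: vx2.
Qed.

(* With [x] near 1 at [w] and near 0 at its other conjugates, the trace of [x * c] is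
   close to [m c], where [m] is the order of the decomposition group. *)
Lemma decomposition_fixed_approx c e :
  (forall g : G, (forall x, w (g x) = w x) -> g c = c) -> 0 < e ->
  exists q, w (c - ratr q) < e.
Proof.
move=> fixc e0; have [t ht] := standard_abs_nontrivial hu.
pose dec (g : G) := `[< forall x, w (g x) = w x >].
pose s := [seq g <- enum {: G} | ~~ dec g].
pose W (g : G) x := w (g x).
have Wt g : W g (ratr t) = u t by rewrite /W galQ_ratr wu.
pose m := #|dec|.
have m0 : (0 < m)%N.
  by apply/card_gt0P; exists 1%g; apply/asboolP => x; rewrite gal_id.
have mN : m%:R != 0 :> N by rewrite -(rmorph_nat (in_alg N)) fmorph_eq0 pnatr_eq0 -lt0n.
have wm : 0 < w m%:R by rewrite absv_gt0.
pose C := \sum_(g : G) w (g c).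
have C0 : 0 <= C by apply: sumr_ge0 => g _; exact: absv_ge0.
(* The total error [d * C] must stay below [e * w m%:R], since the trace is divided by [m] at the
   end. *)
pose d := e * w m%:R / (C + 1).
have d0 : 0 < d by rewrite divr_gt0 ?mulr_gt0 ?ltr_wpDl.
have [|x [wx Wx]] := @absv_weak_approx _ _ _ _ ht _ W w hw absv_galQ
    (wu t) Wt s d _ d0.
  move=> g; rewrite mem_filter => /andP[/asboolPn hg _] E; apply: hg => y.
  by rewrite {2}E.
have [q hq] := galQ_trace (x * c).
exists (q / m%:R).
have -> : c - ratr (q / m%:R) = (m%:R * c - ratr q) / m%:R.
  rewrite ext_ratrM mulrBl [m%:R * c]mulrC mulfK//; congr (_ - _ * _).
  by rewrite !ratr_in_alg fmorphV rmorph_nat.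
rewrite (absv_div hw) ltr_pdivrMr// -hq.
have -> : m%:R * c = \sum_(g : G) (if dec g then c else 0).
  by rewrite -big_mkcond/= sumr_const mulr_natl.
rewrite -sumrB.
apply: le_lt_trans (absv_sum hw _ _ _) _.
apply: le_lt_trans (_ : \sum_(g : G) d * w (g c) < _); last first.
  rewrite -mulr_sumr -/C /d mulrAC ltr_pdivrMr ?ltr_wpDl//.
  by rewrite ltr_pM2l ?mulr_gt0// ltrDl.
apply: ler_sum => g _; rewrite rmorphM/=; case: ifP => hg.
  (* Here [g] preserves [w] and fixes [c], so the term has value [w (1 - x) * w c]. *)
  have hg' := asboolW hg; rewrite (fixc g hg').
  rewrite -[X in X - _]mul1r -mulrBl (absvM hw) ler_wpM2r ?absv_ge0// ltW//.
  by rewrite -(rmorph1 g) -rmorphB/= hg' absvBC.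
rewrite sub0r (absvN hw) (absvM hw) ler_wpM2r ?absv_ge0// ltW//.
by apply: Wx; rewrite mem_filter hg mem_enum.
Qed.

End PlacesAbove.

Lemma rat_primitive_element (K : fieldExtType rat) :
  exists z : K, forall y, exists p : {poly rat}, y = (map_poly (in_alg K) p).[z].
Proof.
have sepK := rat_ext_separable K.
exists (separable_generator 1 {:K}) => y.
have : y \in <<1; separable_generator 1 {:K}>>%VS.
  by rewrite -(eq_adjoin_separable_generator sepK) ?sub1v ?memvf.
by move=> /Fadjoin_polyP[p /polyOver1P[q ->] ->]; exists q.
Qed.

(** * Counting the elements of G by their restriction to K *)

Section EmbeddingCount.
Variables (N : splittingFieldType rat) (K : fieldExtType rat) (j : {rmorphism K -> N}) (z : K).
Hypothesis hz : forall y, exists p : {poly rat}, y = (map_poly (in_alg K) p).[z].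
Local Notation G := (gal_of {:N}%VS).
Implicit Types (g h : G).

(* The degree of N over (the image of) K. *)
Definition stab_card := #|'Gal({:N} / <<1; j z>>)%g|.

Lemma stab_card_gt0 : (0 < stab_card)%N. Proof. exact: fingroup.cardG_gt0. Qed.

Lemma map_in_alg_rmorph (L : fieldExtType rat) (f : {rmorphism K -> L}) (p : {poly rat}) :
  f ((map_poly (in_alg K) p).[z]) = (map_poly (in_alg L) p).[f z].
Proof.
rewrite -horner_map -map_poly_comp; congr (_.[_]).
by apply: eq_map_poly => q /=; rewrite !alg_num_field fmorph_rat.
Qed.

Lemma map_in_alg_gal g (p : {poly rat}) a :
  g ((map_poly (in_alg N) p).[a]) = (map_poly (in_alg N) p).[g a].
Proof.
rewrite -horner_map -map_poly_comp; congr (_.[_]).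
by apply: eq_map_poly => q /=; rewrite rmorph_alg.
Qed.

Lemma gal_eq_on_primitive g h : g (j z) = h (j z) -> forall y, g (j y) = h (j y).
Proof.
move=> gh y; have [p ->] := hz y.
by rewrite map_in_alg_rmorph !map_in_alg_gal gh.
Qed.

(** The field generated by [j z] is the image of [j], so this is the tower law. *)
Lemma stab_card_dim : (\dim {:K} * stab_card)%N = #|{: G}|.
Proof.
have lj : linear j.
  by move=> a x y; rewrite rmorphD/= -[a *: x]mulr_algl rmorphM
    -[a *: j x]mulr_algl !alg_num_field fmorph_rat.
pose jl : {linear K -> N} := HB.pack (j : K -> N) (GRing.isLinear.Build _ _ _ _ (j : K -> N) lj).
have dimE : \dim <<1; j z>>%VS = \dim {:K}.
  have -> : <<1; j z>>%VS = limg (linfun jl).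
    apply/vspaceP => a; apply/idP/idP.
      move=> /Fadjoin_polyP[p /polyOver1P[q ->] ->].
      by rewrite -map_in_alg_rmorph -[j _]/(jl _) -lfunE memv_img ?memvf.
    move=> /memv_imgP[y _ ->]; rewrite lfunE /=; have [p ->] := hz y.
    rewrite map_in_alg_rmorph; apply/Fadjoin_polyP.
    by exists (map_poly (in_alg N) p) => //; apply/polyOver1P; exists p.
  apply: limg_dim_eq; apply/eqP; rewrite -subv0; apply/subvP => y.
  rewrite memv_cap memv_ker lfunE /= => /andP[_].
  by rewrite fmorph_eq0 => /eqP ->; rewrite mem0v.
have gal_jz : galois <<1; j z>> {:N}.
  by apply: galoisS (galQ_galois N); rewrite sub1v subvf.
rewrite galQ_card /stab_card -(galois_dim gal_jz) dimE.
rewrite mulnC divnK// -dimE; exact: field_dimS (subvf _).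
Qed.

(** The fiber is the right coset by [g0] of the group fixing [j z]. *)
Lemma fiber_card (g0 : G) : #|[pred g : G | g (j z) == g0 (j z)]| = stab_card.
Proof.
rewrite /stab_card -(fingroup.card_rcoset _ g0); apply: eq_card => g.
rewrite inE fingroup.mem_rcoset gal_kHom ?subvf//.
apply/eqP/kAHomP => [h a|h].
  move=> /Fadjoin_polyP[p /polyOver1P[q ->] ->].
  rewrite map_in_alg_gal; congr (_.[_]).
  by rewrite galQM h -galQM fingroup.mulgV gal_id.
have : (g * g0^-1)%g (j z) = j z by apply: h; exact: memv_adjoin.
by move=> /(congr1 g0); rewrite -galQM fingroup.mulgKV.
Qed.

End EmbeddingCount.

(** * Local degrees *)

Section RatClosure.
Variables (R : realType) (L : fieldType) (W : L -> R).
Hypothesis hW : absolute_value W.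
(** In positive characteristic [ratr] is not a ring morphism; in a completion of a number field
    these laws are inherited from that field. *)
Hypothesis ratD : forall q r, ratr (q + r) = ratr q + ratr r :> L.
Hypothesis ratM : forall q r, ratr (q * r) = ratr q * ratr r :> L.

Lemma rat_closure_rat q : rat_closure W (ratr q).
Proof. by move=> e e0; exists q; rewrite subrr (absv0 hW). Qed.

Lemma rat_closureD a b : rat_closure W a -> rat_closure W b -> rat_closure W (a + b).
Proof.
move=> ha hb e e0; have e2 : 0 < e / 2 by rewrite divr_gt0.
have [q hq] := ha _ e2; have [r hr] := hb _ e2; exists (q + r).
rewrite ratD opprD addrACA; apply: le_lt_trans (absvD hW _ _) _; lra.
Qed.

Lemma rat_closureN a : rat_closure W a -> rat_closure W (- a).
Proof.
move=> ha e e0; have [q hq] := ha _ e0; exists (- q).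
have -> : ratr (- q) = - ratr q :> L.
  apply/eqP; rewrite -addr_eq0 -ratD addNr; apply/eqP.
  by apply: (addIr (ratr 0)); rewrite -ratD !add0r.
by rewrite -opprD (absvN hW).
Qed.

Lemma rat_closureM a b : rat_closure W a -> rat_closure W b -> rat_closure W (a * b).
Proof.
move=> ha hb e e0.
pose A := W a + 1; pose B := W b + 1.
have A0 : 0 < A by rewrite ltr_wpDl// absv_ge0.
have B0 : 0 < B by rewrite ltr_wpDl// absv_ge0.
have A1 : 0 < A + 1 by rewrite addr_gt0.
pose d := Num.min 1 (e / (2 * B)).
have d0 : 0 < d by rewrite lt_min ltr01/= divr_gt0// mulr_gt0.
have [q hq] := ha _ d0.
have Aq : 0 < e / (2 * (A + 1)) by rewrite divr_gt0// mulr_gt0.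
have [r hr] := hb _ Aq; exists (q * r).
have -> : a * b - ratr (q * r) = (a - ratr q) * b + ratr q * (b - ratr r).
  by rewrite ratM; ring.
apply: le_lt_trans (absvD hW _ _) _.
rewrite (absvM hW (a - ratr q)) (absvM hW (ratr q)).
have h1 : W (a - ratr q) * W b <= e / 2.
  apply: le_trans (_ : e / (2 * B) * B <= _); last by rewrite invfM mulrA divfK// gt_eqF.
  apply: ler_pM; rewrite ?(absv_ge0 hW)//; last by rewrite lerDl.
  by apply/ltW/(lt_le_trans hq); rewrite ge_min lexx orbT.
have h2 : W (ratr q) * W (b - ratr r) < e / 2.
  have qA : W (ratr q) <= A + 1.
    have := absv_lerB hW (ratr q) a; rewrite (absvBC hW).
    have : d <= 1 by rewrite ge_min lexx.
    rewrite /A; have := absv_ge0 hW a; lra.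
  apply: le_lt_trans (ler_wpM2r (absv_ge0 hW _) qA) _.
  by rewrite mulrC -ltr_pdivlMr//; move: hr; rewrite invfM mulrA.
lra.
Qed.

Lemma rat_closure_sum I (r : seq I) (f : I -> L) :
  (forall i, rat_closure W (f i)) -> rat_closure W (\sum_(i <- r) f i).
Proof.
move=> hf; elim/big_ind: _ => //; last exact: rat_closureD.
have -> : 0 = ratr 0 :> L by apply: (addIr (ratr 0)); rewrite -ratD !add0r.
exact: rat_closure_rat.
Qed.

(** The transition matrices satisfy [A *m B = 1%:M] by uniqueness of coordinates, for which the
    entries of the product must lie in the closure; ranks then compare [m] and [n]. *)
Lemma has_degree_le m n : rat_closure W 1 ->
  has_degree (rat_closure W) m -> has_degree (rat_closure W) n -> (m <= n)%N.
Proof.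
move=> E1 [b hb] [b' hb'].
have E0 : rat_closure W 0 by rewrite -(subrr 1); apply: rat_closureD E1 (rat_closureN E1).
have hA i : exists c : 'rV[L]_n, (forall k, rat_closure W (c 0 k)) /\
    b i = \sum_(k < n) c 0 k * b' k.
  by have [c [h _]] := hb' (b i); exists c.
have hB i : exists c : 'rV[L]_m, (forall k, rat_closure W (c 0 k)) /\
    b' i = \sum_(k < m) c 0 k * b k.
  by have [c [h _]] := hb (b' i); exists c.
pose A := \matrix_(i < m, k < n) projT1 (cid (hA i)) 0 k.
pose B := \matrix_(i < n, k < m) projT1 (cid (hB i)) 0 k.
have EA i k : rat_closure W (A i k) by rewrite mxE; case: cid => c [].
have EB i k : rat_closure W (B i k) by rewrite mxE; case: cid => c [].
have bA i : b i = \sum_(k < n) A i k * b' k.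
  under eq_bigr do rewrite mxE; case: cid => c [] //=.
have bB i : b' i = \sum_(k < m) B i k * b k.
  under eq_bigr do rewrite mxE; case: cid => c [] //=.
have AB : A *m B = 1%:M.
  apply/row_matrixP => i; have [c [_ uc]] := hb (b i).
  rewrite -(uc (row i (A *m B))); last first.
    split=> [k|].
      by rewrite !mxE; apply: rat_closure_sum => l; apply: rat_closureM.
    rewrite {1}bA; under eq_bigr do rewrite bB mulr_sumr.
    rewrite exchange_big/=; apply: eq_bigr => k _.
    by rewrite !mxE mulr_suml; apply: eq_bigr => l _; rewrite mulrA.
  apply: uc; split=> [k|].
    by rewrite !mxE; case: (_ == _).
  rewrite (bigD1 i)//= !mxE eqxx mul1r big1 ?addr0// => k ki.
  by rewrite !mxE eq_sym (negbTE ki) mul0r.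
have := mxrankM_maxl A B; rewrite AB mxrank1 => /leq_trans; apply.
exact: rank_leq_col.
Qed.

End RatClosure.

Section LocalDegree.
Variables (R : realType) (N : splittingFieldType rat) (u : rat -> R) (w : N -> R).
Local Notation G := (gal_of {:N}%VS).
Hypothesis hu : standard_abs u.
Hypothesis hw : absolute_value w.
Hypothesis wu : forall q, w (ratr q) = u q.
Variables (K : fieldExtType rat) (j : {rmorphism K -> N}) (z : K).
Hypothesis hz : forall y, exists p : {poly rat}, y = (map_poly (in_alg K) p).[z].
Variable v : K -> R.
Hypothesis hv : absolute_value v.
Hypothesis vu : forall q, v (ratr q) = u q.
Implicit Types (g h : G).

Definition above g : bool := `[< v = fun x => w (g (j x)) >].

Lemma aboveP g : above g -> forall x, v x = w (g (j x)).
Proof. by move=> /asboolP ->. Qed.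

(* The conjugates of the primitive element [z] under the embeddings inducing [v]; their
   number turns out to be [K_v : Q_p], with basis 1, z, z^2, ... *)
Definition nodes : seq N := undup [seq (g : G) (j z) | g <- enum {: G} & above g].

Lemma mem_nodes a : reflect (exists2 g, above g & a = g (j z)) (a \in nodes).
Proof.
rewrite mem_undup; apply: (iffP mapP) => [[g]|[g hg ->]].
  by rewrite mem_filter => /andP[hg _] ->; exists g.
by exists g => //; rewrite mem_filter hg mem_enum.
Qed.

(** Double counting: whether [g] induces [v] depends only on [g (j z)], so the whole fiber over each
    node qualifies. *)
Lemma card_above : #|[pred g | above g]| = (size nodes * stab_card j z)%N.
Proof.
rewrite -sum1_card.
transitivity (\sum_(g | above g) \sum_(a <- nodes) (g (j z) == a))%N.
  apply: eq_bigr => g hg.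
  have gn : g (j z) \in nodes by apply/mem_nodes; exists g.
  under eq_bigr do rewrite eq_sym.
  rewrite -big_mkcond/= sum1_count -[RHS]/(count_mem (g (j z)) nodes).
  by rewrite count_uniq_mem ?undup_uniq ?gn.
rewrite exchange_big/= [RHS](_ : _ = \sum_(a <- nodes) stab_card j z)%N; last first.
  by rewrite big_const_seq count_predT iter_addn_0 mulnC.
apply: eq_big_seq => a /mem_nodes[g0 hg0 ->].
rewrite -(fiber_card j z g0) -sum1_card [RHS]big_mkcond/= [LHS]big_mkcond/=.
apply: eq_bigr => g _; rewrite inE; case: eqP => h; last by case: ifP.
suff -> : above g by [].
apply/asboolP/funext => x; rewrite (aboveP hg0).
by rewrite (gal_eq_on_primitive hz h).
Qed.

Hypothesis above_ex : exists g, above g.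

(* Write [x = p(z)] and reduce [p] modulo the product of the [X - a] over the nodes [a]:
   the remainder is fixed by the decomposition group, which permutes the nodes, so its
   coefficients can be approximated by rationals. *)
Lemma approx_by_powers x e : 0 < e ->
  exists q : 'I_(size nodes) -> rat, v (x - \sum_k ratr (q k) * z ^+ k) < e.
Proof.
move=> e0; have [p hp] := hz x; set n := size nodes.
pose S : {poly N} := \prod_(a <- nodes) ('X - a%:P).
pose P := map_poly (in_alg N) p; pose C := P %% S.
have sS : size S = n.+1 by rewrite size_prod_XsubC.
have sC : (size C <= n)%N by rewrite -ltnS -sS ltn_modp -size_poly_eq0 sS.
have CP a : a \in nodes -> C.[a] = P.[a].
  move=> an; rewrite [in RHS](divp_eq P S) hornerD hornerM.
  have : root S a by rewrite root_prod_XsubC.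
  by move=> /rootP ->; rewrite mulr0 add0r.
have Sfix h : (forall y, w (h y) = w y) -> map_poly h S = S.
  move=> wh; rewrite rmorph_prod/=; under eq_bigr do rewrite rmorphB/= map_polyX map_polyC/=.
  rewrite -(big_map h xpredT (fun a => 'X - a%:P)) /S; apply: perm_big.
  have us : uniq (map h nodes) by rewrite map_inj_uniq ?undup_uniq//; exact: fmorph_inj.
  apply: uniq_perm => //; first exact: undup_uniq.
  have [||//] := @uniq_min_size _ (map h nodes) nodes us.
    move=> _ /mapP[a /mem_nodes[g hg ->] ->]; apply/mem_nodes; exists (g * h)%g.
      by apply/asboolP/funext => y; rewrite galQM wh (aboveP hg).
    by rewrite galQM.
  by rewrite size_map.
have Cfix h : (forall y, w (h y) = w y) -> map_poly h C = C.
  move=> wh; rewrite map_modp Sfix//; congr (_ %% _).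
  by rewrite /P -map_poly_comp; apply: eq_map_poly => r /=; rewrite rmorph_alg.
have [g0 hg0] := above_ex.
pose A := \sum_(k < n) w (g0 (j z)) ^+ k + 1.
have A0 : 0 < A.
  by rewrite ltr_wpDl// sumr_ge0// => k _; rewrite exprn_ge0// absv_ge0.
have eA : 0 < e / A by rewrite divr_gt0.
have hq (k : 'I_n) : exists q, w (C`_k - ratr q) < e / A.
  apply: (decomposition_fixed_approx hu hw wu) => // h wh.
  by rewrite -[in RHS](Cfix h wh) coef_map.
pose q k := projT1 (cid (hq k)).
have hq' (k : 'I_n) : w (C`_k - ratr (q k)) < e / A by rewrite /q; case: cid.
exists q.
rewrite (aboveP hg0).
have -> : g0 (j (x - \sum_k ratr (q k) * z ^+ k)) =
    \sum_(k < n) (C`_k - ratr (q k)) * g0 (j z) ^+ k.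
  rewrite !rmorphB/= !rmorph_sum/=.
  under [X in _ - X]eq_bigr do rewrite (rmorphM j) (rmorphM g0)/= fmorph_rat galQ_ratr !rmorphXn/=.
  under [RHS]eq_bigr do rewrite mulrBl.
  rewrite sumrB; congr (_ - _).
  rewrite hp map_in_alg_rmorph map_in_alg_gal -/P -CP; last by apply/mem_nodes; exists g0.
  by rewrite (horner_coef_wide _ sC).
apply: le_lt_trans (absv_sum hw _ _ _) _.
apply: le_lt_trans (_ : \sum_(k < n) e / A * w (g0 (j z)) ^+ k < _).
  apply: ler_sum => k _; rewrite (absvM hw) (absvX hw).
  by rewrite ler_wpM2r ?exprn_ge0 ?(absv_ge0 hw)// ltW.
by rewrite -mulr_sumr mulrAC ltr_pdivrMr// ltr_pM2l// /A ltrDl.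
Qed.

(** The conjugates of the sum at the nodes all have [w]-value equal to its [v]-value, and the
    inverse Vandermonde matrix of the distinct nodes recovers the coefficients from them. *)
Lemma powers_independent : exists2 M, 0 < M &
  forall (q : 'I_(size nodes) -> rat) k, u (q k) <= M * v (\sum_k ratr (q k) * z ^+ k).
Proof.
set n := size nodes.
pose a : 'rV[N]_n := \row_k nodes`_k.
pose V := Vandermonde n a.
have Vu : V \in unitmx.
  rewrite unitmxE det_Vandermonde unitfE; apply/prodf_neq0 => i _.
  apply/prodf_neq0 => k ik; rewrite !mxE subr_eq0 nth_uniq ?undup_uniq//.
  by rewrite gtn_eqF.
exists (\sum_(k < n) \sum_(l < n) w (invmx V l k) + 1).
  by rewrite ltr_wpDl// sumr_ge0// => k _; rewrite sumr_ge0// => l _; exact: absv_ge0.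
move=> q k; set s := v _.
have s0 : 0 <= s by exact: absv_ge0.
pose c : 'rV[N]_n := \row_k ratr (q k).
have hc : c = c *m V *m invmx V by rewrite mulmxK.
have hy l : w ((c *m V) 0 l) = s.
  have /mem_nodes[g hg Eg] : nodes`_l \in nodes by rewrite mem_nth.
  rewrite /s (aboveP hg) rmorph_sum/= rmorph_sum/= mxE; congr (w _); apply: eq_bigr => i _.
  by rewrite !mxE (rmorphM j) (rmorphM g)/= fmorph_rat galQ_ratr !rmorphXn/= Eg.
have -> : u (q k) = w (c 0 k) by rewrite mxE wu.
rewrite hc mxE; apply: le_trans (absv_sum hw _ _ _) _.
apply: le_trans (_ : (\sum_(l < n) w (invmx V l k)) * s <= _).
  by rewrite mulr_suml; apply: ler_sum => l _; rewrite (absvM hw) hy mulrC.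
rewrite ler_wpM2r// [X in _ <= X + _](bigD1 k)//= -addrA lerDl addr_ge0//.
by rewrite sumr_ge0// => i _; rewrite sumr_ge0// => l _; exact: absv_ge0.
Qed.

Section AnyCompletion.
Variables (L : fieldType) (W : L -> R) (i : {rmorphism K -> L}).
Hypothesis hL : is_completion v W i.

Let hW : absolute_value W. Proof. by case: hL. Qed.
Let Wi x : W (i x) = v x. Proof. by case: hL. Qed.

Lemma completion_ratr q : ratr q = i (ratr q).
Proof. by rewrite fmorph_rat. Qed.

Lemma completion_ratrD q r : ratr (q + r) = ratr q + ratr r :> L.
Proof. by rewrite !completion_ratr ext_ratrD rmorphD. Qed.

Lemma completion_ratrM q r : ratr (q * r) = ratr q * ratr r :> L.
Proof. by rewrite !completion_ratr ext_ratrM rmorphM. Qed.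

(** Rational combinations of powers of [z] approximate [y]; by [powers_independent] their
    coefficients are Cauchy, and the limits are coordinates of [y]. *)
Lemma completion_degree : has_degree (rat_closure W) (size nodes).
Proof.
set n := size nodes; have [M M0 hM] := powers_independent.
have [_ _ dense complete] := hL.
exists (fun k => i z ^+ k) => y.
pose B := \sum_(k < n) W (i z) ^+ k + 1.
have B0 : 0 < B.
  by rewrite ltr_wpDl// sumr_ge0// => k _; rewrite exprn_ge0// absv_ge0.
have sumB (d : 'I_n -> L) e : 0 <= e -> (forall k, W (d k) <= e) ->
    W (\sum_k d k * i z ^+ k) <= e * B.
  move=> e0 hd; apply: le_trans (absv_sum hW _ _ _) _.
  apply: le_trans (_ : \sum_(k < n) e * W (i z) ^+ k <= _).
    apply: ler_sum => k _; rewrite (absvM hW) (absvX hW).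
    by rewrite ler_wpM2r ?exprn_ge0 ?(absv_ge0 hW).
  by rewrite -mulr_sumr ler_wpM2l// lerDl.
pose zz (q : 'I_n -> rat) := \sum_k ratr (q k) * z ^+ k.
have izz q : i (zz q) = \sum_k ratr (q k) * i z ^+ k.
  by rewrite rmorph_sum/=; apply: eq_bigr => k _; rewrite rmorphM/= fmorph_rat rmorphXn.
have hq e : 0 < e -> exists q : 'I_n -> rat, W (y - i (zz q)) < e.
  move=> e0; have e2 : 0 < e / 2 by rewrite divr_gt0.
  have [x hx] := dense y _ e2; have [q hq] := approx_by_powers x e2.
  exists q; apply: le_lt_trans (absv_tri hW (i x) _ _) _.
  by rewrite -rmorphB Wi; move: hx hq; rewrite -/(zz q); lra.
have inv0 m : 0 < m.+1%:R^-1 :> R by rewrite invr_gt0.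
pose Q m := projT1 (cid (hq _ (inv0 m))).
have hQ m : W (y - i (zz (Q m))) < m.+1%:R^-1 by rewrite /Q; case: cid.
have small := @inv_succ_small R.
have uQ m m' k : W (ratr (Q m k) - ratr (Q m' k)) <= M * v (zz (Q m) - zz (Q m')).
  have -> : zz (Q m) - zz (Q m') = \sum_k ratr (Q m k - Q m' k) * z ^+ k.
    rewrite /zz -sumrB; apply: eq_bigr => l _.
    by rewrite !ratr_in_alg rmorphB/= mulrBl.
  rewrite !completion_ratr -rmorphB/= Wi.
  have -> : ratr (Q m k) - ratr (Q m' k) = ratr (Q m k - Q m' k) :> K.
    by rewrite !ratr_in_alg rmorphB.
  by rewrite vu; exact: (hM (fun l => Q m l - Q m' l)).
have cauchyQ k : abs_cauchy W (fun m => ratr (Q m k)).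
  move=> e e0; have d0 : 0 < e / (M * 2) by rewrite divr_gt0// mulr_gt0.
  have [N' HN] := small _ d0; exists N' => m m' hm hm'.
  apply: le_lt_trans (uQ m m' k) _; rewrite -ltr_pdivlMl//.
  rewrite -Wi rmorphB; apply: le_lt_trans (absv_tri hW y _ _) _.
  rewrite [X in X + _](absvBC hW).
  have := lt_trans (hQ m) (HN m hm); have := lt_trans (hQ m') (HN m' hm').
  have -> : M^-1 * e = e / (M * 2) + e / (M * 2) by field; rewrite gt_eqF.
  lra.
have hc k := complete _ (cauchyQ k).
pose c : 'rV[L]_n := \row_k projT1 (cid (hc k)).
have hc' k : abs_cvg W (fun m => ratr (Q m k)) (c 0 k) by rewrite mxE; case: cid.
have cE k : rat_closure W (c 0 k).
  move=> e e0; have [N' HN] := hc' k e e0; exists (Q N' k).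
  by rewrite absvBC//; apply: HN.
have yc : y = \sum_(k < n) c 0 k * i z ^+ k.
  apply/eqP; rewrite -subr_eq0 -(absv_eq0 hW) eq_le absv_ge0// andbT.
  apply/ler_addgt0Pr => e e0; rewrite add0r.
  have d0 : 0 < e / (2 * B) by rewrite divr_gt0// mulr_gt0.
  have [N1 H1] : exists N', forall k m, (N' <= m)%N -> W (ratr (Q m k) - c 0 k) < e / (2 * B).
    have [k _|N' HN] := @eventually_all _
      (fun k m => W (ratr (Q m k) - c 0 k) < e / (2 * B)) (enum 'I_n).
      exact: hc' k _ d0.
    by exists N' => k; apply: HN; rewrite mem_enum.
  have e2 : 0 < e / 2 by rewrite divr_gt0.
  have [N2 H2] := small _ e2; pose m := maxn N1 N2.
  apply: le_trans (absv_tri hW (i (zz (Q m))) _ _) _.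
  have := lt_trans (hQ m) (H2 m (leq_maxr _ _)).
  have : W (i (zz (Q m)) - \sum_(k < n) c 0 k * i z ^+ k) <= e / (2 * B) * B.
    rewrite izz -sumrB; under eq_bigr do rewrite -mulrBl.
    by apply: sumB => [|k]; rewrite ltW// H1// leq_maxl.
  have -> : e / (2 * B) * B = e / 2 by field; rewrite gt_eqF.
  lra.
exists c; split=> // c' [c'E yc'].
apply/rowP => k; apply/eqP; rewrite -subr_eq0 -(absv_eq0 hW) eq_le absv_ge0// andbT.
pose d k := c 0 k - c' 0 k.
have dE k' : rat_closure W (d k').
  by apply: rat_closureD completion_ratrD _ _ _ _ => //; apply: rat_closureN completion_ratrD _ _.
have d_sum : \sum_(k < n) d k * i z ^+ k = 0.
  by under eq_bigr do rewrite mulrBl; rewrite sumrB -yc -yc' subrr.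
apply/ler_addgt0Pr => e e0; rewrite add0r -/(d k).
(* The differences [d k] are only limits of rationals, whereas [powers_independent] needs rational
   coefficients: [d] is approximated within [e'], and the errors [e'] and [M * (e' * B)] add up to
   [e]. *)
pose e' := e / (1 + M * B).
have MB : 0 < 1 + M * B by rewrite addr_gt0// mulr_gt0.
have e'0 : 0 < e' by rewrite divr_gt0.
have hr k' : exists q, W (d k' - ratr q) < e' by exact: dE.
pose r k' := projT1 (cid (hr k')).
have hr' k' : W (d k' - ratr (r k')) < e' by rewrite /r; case: cid.
have h1 : v (zz r) <= e' * B.
  have -> : v (zz r) = W (\sum_k (ratr (r k) - d k) * i z ^+ k).
    by under eq_bigr do rewrite mulrBl; rewrite sumrB d_sum subr0 -izz Wi.
  by apply: sumB => [|k']; rewrite ltW// absvBC.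
have h2 : W (ratr (r k)) <= M * (e' * B).
  rewrite completion_ratr Wi vu; apply: le_trans (hM r k) _.
  by rewrite ler_wpM2l// ltW.
have -> : e = e' + M * (e' * B) by rewrite /e'; field; rewrite gt_eqF.
rewrite -[d k](subrK (ratr (r k))); apply: le_trans (absvD hW _ _) _.
by rewrite lerD// ltW.
Qed.

End AnyCompletion.

(** [completion_degree] holds in every completion and [has_degree_le] makes the degree unique, so
    [xget] has exactly one candidate. *)
Lemma local_degreeE : local_degree v = size nodes.
Proof.
apply: xget_unique.
  have [L [W [i hL]]] := completion_exists hv.
  by exists L, W, i; split=> //; exact: completion_degree hL.
move=> m [L [W [i [hL hm]]]]; have hn := completion_degree hL.
have [hW _ _ _] := hL.
have D := completion_ratrD i; have M := completion_ratrM i.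
have E1 : rat_closure W 1.
  have -> : 1 = ratr 1 :> L by rewrite (completion_ratr i) ext_ratr1 rmorph1.
  exact: rat_closure_rat.
by apply/eqP; rewrite eqn_leq !(has_degree_le hW D M).
Qed.

Lemma local_degree_card : #|[pred g | above g]| = (local_degree v * stab_card j z)%N.
Proof. by rewrite local_degreeE card_above. Qed.

End LocalDegree.

(** * Heights as products over a Galois group *)

(* [None] stands for the infinite place of Q, [Some p] for the prime [p]. *)
Section Bases.
Variable R : realType.
Implicit Types (o : option nat) (B p : nat) (q : rat).

Definition base_abs o : rat -> R :=
  if o is Some p then padic_abs R p else fun q => `|ratr q|.

Definition base_valid o : bool := if o is Some p then prime p else true.

Definition bases B : seq (option nat) :=
  None :: [seq Some p | p <- [seq p <- iota 0 B.+1 | prime p]].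

Lemma bases_valid B o : o \in bases B -> base_valid o.
Proof.
rewrite inE => /orP[/eqP-> //|/mapP[p]].
by rewrite mem_filter => /andP[pp _] ->.
Qed.

Lemma bases_uniq B : uniq (bases B).
Proof.
rewrite cons_uniq map_inj_uniq; last by move=> ? ? [].
by rewrite filter_uniq ?iota_uniq// andbT; apply/negP => /mapP[].
Qed.

Lemma mem_bases B p : (p <= B)%N -> prime p -> Some p \in bases B.
Proof.
move=> pB pp; rewrite inE; apply/orP; right; apply/mapP; exists p => //.
by rewrite mem_filter pp mem_iota.
Qed.

Lemma base_standard o : base_valid o -> standard_abs (base_abs o).
Proof. by case: o => [p|] h; [right; exists p|left]. Qed.

Lemma standard_base (u : rat -> R) : standard_abs u ->
  exists2 o, base_valid o & u = base_abs o.
Proof. by case=> [->|[p pp ->]]; [exists None|exists (Some p)]. Qed.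

(** A prime [p] has value less than 1 at [p], equal to 1 at other primes, and greater than 1 at
    infinity. *)
Lemma base_abs_inj o o' : base_valid o -> base_valid o' ->
  base_abs o = base_abs o' -> o = o'.
Proof.
have pp_abs p p' : prime p -> prime p' -> p != p' -> padic_abs R p' p%:R = 1.
  move=> hp hp' ne; have p0 : Posz p != 0 by rewrite eqz_nat -lt0n prime_gt0.
  by rewrite -[p%:R]/((Posz p)%:Q) padic_abs_int// logn_prime// eq_sym (negbTE ne) expr0 invr1.
have p_abs p : prime p -> padic_abs R p p%:R < 1.
  move=> hp; have p0 : Posz p != 0 by rewrite eqz_nat -lt0n prime_gt0.
  rewrite -[p%:R]/((Posz p)%:Q) padic_abs_int// logn_prime// eqxx expr1.
  by rewrite invf_lt1 ?ltr0n ?ltr1n ?prime_gt1 ?prime_gt0.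
have inf p : prime p -> `|ratr p%:R| > 1 :> R.
  by move=> hp; rewrite ratr_nat ger0_norm ?ltr1n ?prime_gt1.
case: o => [p|]; case: o' => [p'|] //= hp hp' E.
- congr Some; apply/eqP; apply: contraT => ne.
  by have := p_abs p hp; rewrite E pp_abs// ltxx.
- by have := p_abs p hp; rewrite E => /lt_trans/(_ (inf p hp)); rewrite ltxx.
- by have := p_abs p' hp'; rewrite -E => /lt_trans/(_ (inf p' hp')); rewrite ltxx.
Qed.

Definition norm_max (F : Type) (n : nat) (v : F -> R) (y : 'rV[F]_n) : R :=
  \big[Num.max/0]_(k < n) v (y 0 k).

Lemma norm_max_ge (F : Type) n (v : F -> R) (y : 'rV[F]_n) k : v (y 0 k) <= norm_max v y.
Proof. exact: le_bigmax_cond. Qed.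

Lemma norm_max_ge0 (F : Type) n (v : F -> R) (y : 'rV[F]_n) : 0 <= norm_max v y.
Proof. by apply: bigmax_ge_id. Qed.

Lemma norm_max_le (F : Type) n (v : F -> R) (y : 'rV[F]_n) m : 0 <= m ->
  (forall k, v (y 0 k) <= m) -> norm_max v y <= m.
Proof. by move=> m0 h; apply: bigmax_le => // k _. Qed.

Lemma norm_max_gt0 (F : fieldType) n (v : F -> R) (y : 'rV[F]_n) :
  absolute_value v -> y != 0 -> 0 < norm_max v y.
Proof.
move=> hv /rV0Pn[k yk]; apply: lt_le_trans (norm_max_ge v y k).
by rewrite absv_gt0.
Qed.

Lemma norm_maxZ (F : fieldType) n (v : F -> R) c (y : 'rV[F]_n) : absolute_value v ->
  norm_max v (c *: y) = v c * norm_max v y.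
Proof.
move=> hv; have [->|c0] := eqVneq c 0.
  rewrite scale0r (absv0 hv) mul0r; apply/eqP; rewrite eq_le norm_max_ge0 andbT.
  by apply: norm_max_le => // k; rewrite mxE (absv0 hv).
have vc : 0 < v c by rewrite absv_gt0.
apply/eqP; rewrite eq_le; apply/andP; split.
  apply: norm_max_le => [|k]; first by rewrite mulr_ge0 ?norm_max_ge0 ?absv_ge0.
  by rewrite mxE (absvM hv) ler_pM2l// norm_max_ge.
rewrite -ler_pdivlMl//; apply: norm_max_le => [|k].
  by rewrite mulr_ge0 ?norm_max_ge0// invr_ge0 absv_ge0.
by rewrite ler_pdivlMl//; have := norm_max_ge v (c *: y) k; rewrite mxE (absvM hv).
Qed.

Lemma norm_max_map (F L : Type) n (v : L -> R) (f : F -> L) (y : 'rV[F]_n) :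
  norm_max v (map_mx f y) = norm_max (fun x => v (f x)) y.
Proof. by apply: eq_bigr => k _; rewrite mxE. Qed.

End Bases.

(** * Integrality at almost all primes *)

Section AlmostAllIntegral.
Variables (R : realType) (K : fieldExtType rat).

Lemma padic_nat_le1 p (v : K -> R) : prime p ->
  (forall q, v (ratr q) = padic_abs R p q) -> forall n : nat, v n%:R <= 1.
Proof.
move=> pp vp n; have -> : n%:R = ratr n%:R :> K by rewrite ratr_in_alg rmorph_nat.
by rewrite vp padic_abs_le1.
Qed.

(** Beyond all denominators of the minimal polynomial its coefficients have value at most 1; if
    [v x > 1], the leading term would exceed all others. *)
Lemma almost_all_le1 (x : K) : exists B, forall p, (B <= p)%N -> prime p ->
  forall v : K -> R, absolute_value v -> (forall q, v (ratr q) = padic_abs R p q) ->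
  v x <= 1.
Proof.
have /polyOver1P[f hf] := minPolyOver 1 x.
have mf : f \is monic by rewrite -(map_monic (in_alg K)) -hf monic_minPoly.
have rf : (map_poly (in_alg K) f).[x] = 0 by rewrite -hf; apply/rootP; exact: root_minPoly.
exists (\sum_(i < size f) `|denq f`_i|%N).+1 => p Bp pp v hv vp.
have vn := padic_nat_le1 pp vp.
have fi i : v (ratr f`_i) <= 1.
  rewrite vp; have [i_f|f_i] := ltnP i (size f); last first.
    by rewrite nth_default// /padic_abs eqxx.
  rewrite /padic_abs; case: ifP => // _.
  have /logn_lt -> : (`|denq f`_i| < p)%N.
    apply: leq_ltn_trans Bp.
    by rewrite (bigD1 (Ordinal i_f))//= leq_addr.
  rewrite expr0 div1r invf_le1 ?exprn_gt0 ?ltr0n ?prime_gt0//.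
  by rewrite exprn_ege1// ler1n prime_gt0.
rewrite leNgt; apply/negP => vx.
have vx0 : 0 < v x := lt_trans ltr01 vx.
have f0 : f != 0 := monic_neq0 mf.
have : (0 < (size f).-1)%N.
  rewrite lt0n; apply/eqP => sf.
  have sf1 : size f = 1%N by case: (size f) (size_poly_eq0 f) sf f0 => [|[|]] //= <-.
  have /size1_polyC Ef : (size f <= 1)%N by rewrite sf1.
  move: rf; rewrite Ef map_polyC hornerC => /eqP.
  rewrite fmorph_eq0 => /eqP f00; move/monicP: mf; rewrite /lead_coef sf1/= f00.
  by move=> /esym/eqP; rewrite oner_eq0.
move En : (size f).-1 => [//|n] _.
have sf : size f = n.+2 by case: (size f) En => //= m ->.
move: rf; rewrite horner_coef size_map_poly sf big_ord_recr/= coef_map/=.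
have -> : f`_n.+1 = 1 by move/monicP: mf; rewrite /lead_coef sf.
rewrite scale1r mul1r addrC => /eqP; rewrite addr_eq0 => /eqP /(congr1 v).
rewrite (absvN hv) (absvX hv) => E.
have : v x ^+ n.+1 <= v x ^+ n.
  rewrite E; apply: absv_ultra_sum => //; first by rewrite exprn_ge0 ?ltW.
  move=> i _; rewrite coef_map/= alg_num_field (absvM hv) (absvX hv).
  apply: le_trans (_ : 1 * v x ^+ i <= _); first by rewrite ler_wpM2r ?exprn_ge0 ?(ltW vx0).
  by rewrite mul1r ler_weXn2l ?(ltW vx)// -ltnS.
by rewrite exprS ger_pMl ?exprn_gt0// leNgt vx.
Qed.

Lemma almost_all_eq1 (x : K) : x != 0 -> exists B, forall p, (B <= p)%N -> prime p ->
  forall v : K -> R, absolute_value v -> (forall q, v (ratr q) = padic_abs R p q) ->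
  v x = 1.
Proof.
move=> x0; have [B1 h1] := almost_all_le1 x; have [B2 h2] := almost_all_le1 x^-1.
exists (maxn B1 B2) => p; rewrite geq_max => /andP[b1 b2] pp v hv vp.
apply/eqP; rewrite eq_le (h1 p)//=; have := h2 p b2 pp v hv vp.
by rewrite (absvV hv) invf_le1// absv_gt0.
Qed.

Lemma almost_all_norm_max n (y : 'rV[K]_n) : y != 0 ->
  exists B, forall p, (B <= p)%N -> prime p ->
  forall v : K -> R, absolute_value v -> (forall q, v (ratr q) = padic_abs R p q) ->
  norm_max v y = 1.
Proof.
move=> /rV0Pn[k0 yk0]; have [B0 h0] := almost_all_eq1 yk0.
have [k _|B1 h1] := @eventually_all _ (fun k p => prime p ->
  forall v : K -> R, absolute_value v -> (forall q, v (ratr q) = padic_abs R p q) ->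
  v (y 0 k) <= 1) (enum 'I_n).
  exact: almost_all_le1.
exists (maxn B0 B1) => p; rewrite geq_max => /andP[b0 b1] pp v hv vp.
apply/eqP; rewrite eq_le; apply/andP; split.
  by apply: norm_max_le => // k; apply: (h1 k _ p) => //; rewrite mem_enum.
by rewrite -(h0 p b0 pp v hv vp) norm_max_ge.
Qed.

End AlmostAllIntegral.

Section HeightOverK.
Variables (R : realType) (N : splittingFieldType rat) (w : option nat -> N -> R).
Local Notation G := (gal_of {:N}%VS).
Hypothesis hw : forall o, base_valid o -> absolute_value (w o).
Hypothesis wu : forall o, base_valid o -> forall q, w o (ratr q) = base_abs R o q.

(* The factors over the infinite place and the primes up to B of H_N(x); by Galois
   conjugacy, the places of N over [o] are the [w o \o g], each with multiplicity its
   local degree. *)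
Definition partial_height (B : nat) n (x : 'rV[N]_n) : R :=
  \prod_(o <- bases B) \prod_(g : G) norm_max (fun a => w o (g a)) x.

Variables (K : fieldExtType rat) (j : {rmorphism K -> N}) (z : K).
Hypothesis hz : forall y, exists p : {poly rat}, y = (map_poly (in_alg K) p).[z].

Definition places_over o : seq (K -> R) :=
  undup [seq (fun x => w o (g (j x))) | g : G <- enum {: G}].

Lemma places_overP o v : base_valid o ->
  reflect (absolute_value v /\ forall q, v (ratr q) = base_abs R o q) (v \in places_over o).
Proof.
move=> ho; rewrite mem_undup; apply: (iffP mapP) => [[g _ ->]|[hv vu]].
  split; last by move=> q; rewrite fmorph_rat galQ_ratr wu.
  exact: (absv_comp j (absv_galQ (hw ho) g)).
have [g ->] := place_above (base_standard R ho) (hw ho) (wu ho) j hv vu.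
by exists g => //; rewrite mem_enum.
Qed.

(** Groups the elements of G by the absolute value they induce on K, using the class sizes from
    [local_degree_card]. *)
Lemma places_over_prod o (f : (K -> R) -> R) : base_valid o ->
  \prod_(g : G) f (fun x => w o (g (j x))) =
  (\prod_(v <- places_over o) f v ^+ local_degree v) ^+ stab_card j z.
Proof.
move=> ho.
transitivity (\prod_(g : G) \prod_(v <- places_over o) (if above (w o) j v g then f v else 1)).
  apply: eq_bigr => g _; set v0 := fun x => _.
  have v0in : v0 \in places_over o.
    by rewrite mem_undup; apply/mapP; exists g => //; rewrite mem_enum.
  rewrite (bigD1_seq v0) ?undup_uniq//= {1}/above asboolT// big1 ?mulr1// => v vv0.
  by rewrite /above asboolF// => E; rewrite E eqxx in vv0.
rewrite exchange_big/= -prodrXl; apply: eq_big_seq => v /(places_overP _ ho)[hv vu].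
have [g hg] := place_above (base_standard R ho) (hw ho) (wu ho) j hv vu.
rewrite -big_mkcond/= prodr_const -exprM.
rewrite -(local_degree_card (base_standard R ho) (hw ho) (wu ho) hz hv vu)//.
by exists g; apply/asboolP.
Qed.

Lemma uniq_flatten_places s : uniq s -> all base_valid s ->
  uniq (flatten [seq places_over o | o <- s]).
Proof.
elim: s => //= o s IH /andP[os us] /andP[vo vs].
rewrite cat_uniq undup_uniq IH//= andbT; apply/hasPn => v vin.
have /flatten_mapP [ o2 o2s] := vin.
have vo2 := allP vs o2 o2s.
move=> /(places_overP _ vo2)[_ h']; apply/negP => /(places_overP _ vo)[_ h].
have E : o = o2 by apply: (@base_abs_inj R _ _ vo vo2); apply/funext => q; rewrite -h -h'.
by rewrite E o2s in os.
Qed.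

(** The places missing from the list lie over primes greater than [B], where the maximum is 1, so
    the finitely supported product reduces to the list. *)
Lemma mult_height_over_formula n (y : 'rV[K]_n) : y != 0 ->
  exists B0, forall B, (B0 <= B)%N ->
  mult_height_over R y ^+ stab_card j z = partial_height B (map_mx j y).
Proof.
move=> y0; have [B0 h0] := almost_all_norm_max R y0.
exists B0 => B B0B.
pose F (v : K -> R) := norm_max v y ^+ local_degree v.
have -> : mult_height_over R y = \prod_(v <- flatten [seq places_over o | o <- bases B]) F v.
  have vB : all base_valid (bases B) by apply/allP => o; exact: bases_valid.
  rewrite fsbig_seq; last exact: uniq_flatten_places (bases_uniq _) vB.
  apply/esym/fsbig_widen => [v vin|v [pv nv]].
    have /flatten_mapP [ o oB] : v \in flatten [seq places_over o | o <- bases B] by exact: vin.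
    have vo := bases_valid oB.
    move=> /(places_overP _ vo)[hv vu]; split=> //.
    rewrite (_ : (fun q => _) = base_abs R o); last exact/funext.
    exact: base_standard.
  have [hv /standard_base[ o vo E]] := pv.
  have vu q : v (ratr q) = base_abs R o q by rewrite -E.
  have vin : v \in places_over o by apply/places_overP.
  have oB : o \notin bases B.
    by apply/negP => oB; apply: nv; apply/flatten_mapP; exists o.
  case: o vo vu oB {E vin} => [p|]; last by rewrite inE.
  move=> /= pp vu pB; rewrite /F [norm_max v y](h0 p) ?expr1n//.
  rewrite (leq_trans B0B)// leqNgt; apply: contra pB => pB.
  by apply: mem_bases => //; exact: ltnW.
rewrite big_flatten big_map -prodrXl; apply: eq_big_seq => o oB.
have vo := bases_valid oB.
rewrite -(places_over_prod (fun v => norm_max v y) vo).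
by apply: eq_bigr => g _; rewrite norm_max_map.
Qed.

End HeightOverK.

(** * The product formula, over Q and over N *)

Lemma prod_prime_powers (R : realType) n B : (0 < n)%N -> (n <= B)%N ->
  \prod_(p <- iota 0 B.+1 | prime p) (p%:R ^+ logn p n) = n%:R :> R.
Proof.
move=> n0 nB; have := widen_partn predT nB; rewrite partnT// => E.
rewrite [in RHS]E natr_prod/= /index_iota subn0 big_mkcond/=.
apply: eq_bigr => p _; rewrite natrX; case: ifP => // pp.
by rewrite lognE pp expr0.
Qed.

Lemma product_formula_rat (R : realType) (q : rat) : q != 0 ->
  exists B0, forall B, (B0 <= B)%N -> \prod_(o <- bases B) base_abs R o q = 1.
Proof.
move=> q0; exists (`|numq q| + `|denq q|)%N => B hB.
have n0 : (0 < `|numq q|)%N by rewrite absz_gt0 numq_eq0.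
have d0 : (0 < `|denq q|)%N by rewrite absz_gt0 denq_neq0.
have nR : `|numq q|%N%:R != 0 :> R by rewrite pnatr_eq0 -lt0n.
have dR : `|denq q|%N%:R != 0 :> R by rewrite pnatr_eq0 -lt0n.
rewrite /bases big_cons big_map big_filter.
have -> : \prod_(p <- iota 0 B.+1 | prime p) base_abs R (Some p) q =
    `|denq q|%N%:R / `|numq q|%N%:R.
  rewrite -(@prod_prime_powers R `|denq q| B)//; last by apply: leq_trans hB; rewrite leq_addl.
  rewrite -(@prod_prime_powers R `|numq q| B)//; last by apply: leq_trans hB; rewrite leq_addr.
  by rewrite -prodfV -big_split/=; apply: eq_bigr => p _; rewrite /padic_abs (negbTE q0).
have -> : base_abs R None q = `|numq q|%N%:R / `|denq q|%N%:R.
  by rewrite /= /ratr normrM normfV !natr_absz -!intr_norm.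
by rewrite mulf_div [X in X / _]mulrC divff// mulf_neq0.
Qed.

Section ProductFormula.
Variables (R : realType) (N : splittingFieldType rat) (w : option nat -> N -> R).
Local Notation G := (gal_of {:N}%VS).
Hypothesis hw : forall o, base_valid o -> absolute_value (w o).
Hypothesis wu : forall o, base_valid o -> forall q, w o (ratr q) = base_abs R o q.

(** The inner product is the standard absolute value of the norm of [c], a nonzero rational. *)
Lemma product_formula (c : N) : c != 0 -> exists B0, forall B, (B0 <= B)%N ->
  \prod_(o <- bases B) \prod_(g : G) w o (g c) = 1.
Proof.
move=> c0; have [q hq] : exists q, \prod_(g : G) g c = ratr q.
  apply: galQ_fixed => h; rewrite rmorph_prod/=.
  rewrite [RHS](reindex_inj (mulIg h))/=; apply: eq_bigr => g _.
  by rewrite galQM.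
have q0 : q != 0.
  apply: contra_neq c0 => q0; move: hq; rewrite q0 ext_ratr0 => /eqP/prodf_eq0[g _].
  by rewrite fmorph_eq0 => /eqP.
have [B0 h0] := product_formula_rat R q0; exists B0 => B hB.
apply: etrans (h0 B hB); apply: eq_big_seq => o /bases_valid vo.
by rewrite -(wu vo) -hq (absv_prod (hw vo)).
Qed.

Lemma partial_heightZ (c : N) n : c != 0 -> exists B0, forall B, (B0 <= B)%N ->
  forall x : 'rV[N]_n, partial_height w B (c *: x) = partial_height w B x.
Proof.
move=> /product_formula[B0 h0]; exists B0 => B hB x.
rewrite -[RHS]mul1r -[X in X * _](h0 B hB) -big_split/=; apply: eq_big_seq => o /bases_valid vo.
rewrite -big_split/=; apply: eq_bigr => g _.
exact: norm_maxZ (absv_galQ (hw vo) g).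
Qed.

Lemma partial_height_gt0 B n (x : 'rV[N]_n) : x != 0 -> 0 < partial_height w B x.
Proof.
move=> x0; rewrite /partial_height big_seq; apply: prodr_gt0 => o /bases_valid vo.
apply: prodr_gt0 => g _; exact: norm_max_gt0 (absv_galQ (hw vo) g) x0.
Qed.

End ProductFormula.

(** * Constructing N and its absolute values *)

Lemma extended_absv_exists (R : realType) (N : splittingFieldType rat) :
  exists w : option nat -> N -> R,
    (forall o, base_valid o -> absolute_value (w o)) /\
    (forall o, base_valid o -> forall q, w o (ratr q) = base_abs R o q).
Proof.
have h o : exists v : N -> R, base_valid o ->
    absolute_value v /\ forall q, v (ratr q) = base_abs R o q.
  case vo : (base_valid o); last by exists (fun=> 0).
  have [v hv] := absv_extension N (standard_absolute_value (base_standard R vo)).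
  by exists v.
exists (fun o => projT1 (cid (h o))).
by split=> o vo; case: cid => v /= /(_ vo)[].
Qed.

(** All roots of the minimal polynomials are adjoined, which makes the field normal over Q. *)
Lemma splitting_field_containing (s : seq algC) :
  exists (N : splittingFieldType rat) (nu : {rmorphism N -> algC}),
    forall a, a \in s -> exists b, nu b = a.
Proof.
have hr (a : algC) : exists pr : {poly rat} * seq algC,
    map_poly ratr pr.1 = \prod_(z <- pr.2) ('X - z%:P) /\ a \in pr.2.
  have [p [pE mp] hp] := minCpolyP a.
  have [r rE] := closed_field_poly_normal (minCpoly a).
  exists (p, r); rewrite /= -pE rE (monicP (minCpoly_monic a)) scale1r; split=> //.
  by rewrite -root_prod_XsubC -[X in root X]scale1r -(monicP (minCpoly_monic a)) -rE root_minCpoly.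
pose P a := (projT1 (cid (hr a))).1; pose r a := (projT1 (cid (hr a))).2.
have Pr a : map_poly ratr (P a) = \prod_(z <- r a) ('X - z%:P) :> {poly algC}.
  by rewrite /P /r; case: cid => x [].
have ar a : a \in r a by rewrite /r; case: cid => x [].
pose s' := flatten [seq r a | a <- s].
have [L [nu [s1 s1E genL]]] := num_field_exists s'.
have axL : SplittingField.axiom L.
  exists (map_poly (in_alg L) (\prod_(a <- s) P a)); first by apply/polyOver1P; eexists.
  exists s1 => //.
  suff -> : map_poly (in_alg L) (\prod_(a <- s) P a) = \prod_(z <- s1) ('X - z%:P) by exact: eqpxx.
  apply: (map_poly_inj nu); rewrite -map_poly_comp.
  rewrite (@eq_map_poly _ _ _ ratr) => [|q]; last first.
    by rewrite /= alg_num_field fmorph_rat.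
  rewrite !rmorph_prod/=.
  under [RHS]eq_bigr do rewrite rmorphB/= map_polyX map_polyC/=.
  rewrite -(big_map nu xpredT (fun z => 'X - z%:P)) s1E big_flatten big_map.
  by apply: eq_bigr => a _; exact: Pr.
pose N : splittingFieldType rat :=
  HB.pack L (FieldExt_isSplittingField.Build rat L axL).
exists N, (nu : {rmorphism N -> algC}) => a a_s.
have : a \in map nu s1 by rewrite s1E; apply/flatten_mapP; exists a.
by move=> /mapP[b _ ->]; exists b.
Qed.

(** The image of [nu] is a Q-subspace containing the image of a basis, hence all of [iota];
    injectivity of [nu] transports the morphism laws. *)
Lemma lift_embedding (K : fieldExtType rat) (iota : {rmorphism K -> algC})
    (N : fieldExtType rat) (nu : {rmorphism N -> algC}) :
  (forall a, a \in [seq iota b | b <- vbasis {:K}] -> exists b, nu b = a) ->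
  exists j : {rmorphism K -> N}, forall y, nu (j y) = iota y.
Proof.
move=> h.
have hj y : exists b, nu b = iota y.
  have hb (k : 'I_(\dim {:K})) : exists b, nu b = iota (vbasis {:K})`_k.
    by apply: h; apply: map_f; rewrite mem_nth ?size_tuple.
  exists (\sum_k coord (vbasis {:K}) k y *: projT1 (cid (hb k))).
  rewrite {2}(coord_vbasis (memvf y)) !rmorph_sum/=; apply: eq_bigr => k _.
  by rewrite !rmorphZ_num; case: cid => b /= ->.
pose j y := projT1 (cid (hj y)).
have jE y : nu (j y) = iota y by rewrite /j; case: cid.
have jB : zmod_morphism j.
  by move=> a b; apply: (fmorph_inj nu); rewrite rmorphB !jE rmorphB.
have jM : monoid_morphism j.
  by split=> [|a b]; apply: (fmorph_inj nu); rewrite ?rmorph1 ?rmorphM !jE ?rmorph1 ?rmorphM.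
pose jr : {rmorphism K -> N} := HB.pack (j : K -> N)
  (GRing.isZmodMorphism.Build K N j jB) (GRing.isMonoidMorphism.Build K N j jM).
by exists jr.
Qed.

Lemma mult_height_over_ge0 (R : realType) (K : fieldExtType rat) n (y : 'rV[K]_n) :
  0 <= mult_height_over R y.
Proof.
apply: prodr_ge0 => v _; rewrite exprn_ge0//; exact: norm_max_ge0.
Qed.

(** * Independence of the height from the field and the coordinates *)

Section HeightWellDefined.
Variable R : realType.

Lemma map_mx_neq0 (K L : fieldType) (f : {rmorphism K -> L}) n (y : 'rV[K]_n) :
  (map_mx f y != 0) = (y != 0).
Proof. by rewrite map_mx_eq0. Qed.

Lemma normalized_height_formula (N : splittingFieldType rat) (w : option nat -> N -> R)
    (hw : forall o, base_valid o -> absolute_value (w o))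
    (wu : forall o, base_valid o -> forall q, w o (ratr q) = base_abs R o q)
    (K : fieldExtType rat) (j : {rmorphism K -> N}) n (y : 'rV[K]_n) : y != 0 ->
  exists B0, forall B, (B0 <= B)%N ->
    mult_height_over R y `^ (\dim {:K})%:R^-1 =
    partial_height w B (map_mx j y) `^ #|{: gal_of {:N}%VS}|%:R^-1.
Proof.
move=> y0; have [z hz] := rat_primitive_element K.
have [B0 h0] := mult_height_over_formula hw wu j hz y0.
exists B0 => B hB; rewrite -(h0 B hB) -(stab_card_dim j hz) natrM invfM.
have s0 : (stab_card j z)%:R != 0 :> R by rewrite pnatr_eq0 -lt0n stab_card_gt0.
by rewrite -powR_mulrn ?mult_height_over_ge0// -powRrM mulrCA mulfV// mulr1.
Qed.

Definition height_values n (x : 'rV[algC]_n) : set R :=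
  [set r | exists (K : fieldExtType rat) (iota : {rmorphism K -> algC})
                  (y : 'rV[K]_n) (c : algC),
      [/\ c != 0, map_mx iota y = c *: x &
          r = mult_height_over R y `^ (\dim {:K})%:R^-1]]%classic.

Lemma height_values_unique n (x : 'rV[algC]_n) r1 r2 : x != 0 ->
  height_values x r1 -> height_values x r2 -> r1 = r2.
Proof.
move=> x0 [K1 [i1 [y1 [c1 [c10 E1 ->]]]]] [K2 [i2 [y2 [c2 [c20 E2 ->]]]]].
have [N [nu hN]] := splitting_field_containing
  ([seq i1 b | b <- vbasis {:K1}] ++ [seq i2 b | b <- vbasis {:K2}]).
have [|j1 h1] := @lift_embedding K1 i1 N nu.
  by move=> a ha; apply: hN; rewrite mem_cat ha.
have [|j2 h2] := @lift_embedding K2 i2 N nu.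
  by move=> a ha; apply: hN; rewrite mem_cat ha orbT.
have [w [hw wu]] := extended_absv_exists R N.
have y10 : y1 != 0 by rewrite -(map_mx_neq0 i1) E1 scaler_eq0 negb_or c10.
have y20 : y2 != 0 by rewrite -(map_mx_neq0 i2) E2 scaler_eq0 negb_or c20.
have nu1 : map_mx nu (map_mx j1 y1) = c1 *: x.
  by rewrite -map_mx_comp -E1; apply/rowP => k; rewrite !mxE /= h1.
have nu2 : map_mx nu (map_mx j2 y2) = c2 *: x.
  by rewrite -map_mx_comp -E2; apply/rowP => k; rewrite !mxE /= h2.
(* The ratio [c2 / c1] is a priori only in [algC]; a nonzero coordinate exhibits it in N, where
   [partial_heightZ] applies. *)
have [c [cn0 Ec]] : exists c : N, c != 0 /\ map_mx j2 y2 = c *: map_mx j1 y1.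
  have /rV0Pn[k yk] : map_mx j1 y1 != 0 by rewrite map_mx_neq0.
  pose c := map_mx j2 y2 0 k / map_mx j1 y1 0 k.
  have nuc : nu c = c2 / c1.
    have xk : c1 * x 0 k != 0.
      move: yk; rewrite -(fmorph_eq0 nu).
      by have /rowP/(_ k) := nu1; rewrite mxE [RHS]mxE => ->.
    rewrite fmorph_div.
    have /rowP/(_ k) := nu1; rewrite mxE [RHS]mxE => ->.
    have /rowP/(_ k) := nu2; rewrite mxE [RHS]mxE => ->.
    move: xk; rewrite mulf_eq0 negb_or => /andP[_ xk].
    by field; rewrite c10.
  exists c; split.
    by rewrite -(fmorph_eq0 nu) nuc mulf_neq0// invr_neq0.
  apply: (map_mx_inj (f := nu)); rewrite nu2 map_mxZ nu1 nuc scalerA divfK//.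
have [B1 H1] := normalized_height_formula hw wu j1 y10.
have [B2 H2] := normalized_height_formula hw wu j2 y20.
have [B3 H3] := partial_heightZ hw wu n cn0.
pose B := maxn B1 (maxn B2 B3).
by rewrite (H1 B) ?(H2 B) ?Ec ?(H3 B)//; rewrite /B; lia.
Qed.

Lemma mult_height_value n (x : 'rV[algC]_n) r : x != 0 ->
  height_values x r -> mult_height R x = r.
Proof.
move=> x0 xr; apply: xget_unique => // r' xr'; exact: height_values_unique xr' xr.
Qed.

Lemma mult_height_formula (N : splittingFieldType rat) (nu : {rmorphism N -> algC})
    (w : option nat -> N -> R)
    (hw : forall o, base_valid o -> absolute_value (w o))
    (wu : forall o, base_valid o -> forall q, w o (ratr q) = base_abs R o q)
    n (X : 'rV[N]_n) : X != 0 ->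
  exists B0, forall B, (B0 <= B)%N ->
    mult_height R (map_mx nu X) = partial_height w B X `^ #|{: gal_of {:N}%VS}|%:R^-1.
Proof.
move=> X0; have [B0 H0] := normalized_height_formula hw wu idfun X0.
exists B0 => B hB; have := H0 B hB.
have -> : map_mx idfun X = X by apply/rowP => k; rewrite mxE.
move=> <-.
apply: mult_height_value; first by rewrite map_mx_neq0.
by exists N, nu, X, 1; split; rewrite ?oner_neq0 ?scale1r.
Qed.

Lemma height_formula (N : splittingFieldType rat) (nu : {rmorphism N -> algC})
    (w : option nat -> N -> R)
    (hw : forall o, base_valid o -> absolute_value (w o))
    (wu : forall o, base_valid o -> forall q, w o (ratr q) = base_abs R o q)
    n (X : 'rV[N]_n) : X != 0 ->
  exists B0, forall B, (B0 <= B)%N ->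
    #|{: gal_of {:N}%VS}|%:R * height R (map_mx nu X) = ln (partial_height w B X).
Proof.
move=> /(mult_height_formula nu hw wu)[B0 H0]; exists B0 => B /H0 h.
rewrite /height h ln_powR mulrA mulfV ?mul1r// pnatr_eq0 -lt0n.
by apply/card_gt0P; exists 1%g.
Qed.

End HeightWellDefined.

(** * Local estimates for polynomial maps *)

Lemma ord2P (k : 'I_2) : k = 0 \/ k = 1.
Proof. by case: k => [[|[|//]] hk]; [left|right]; apply/eqP. Qed.

(** As [beta >= 1] and [k > 0], one has [beta <= beta ^+ k], and [beta * t <= s / 2]. *)
Lemma dominated_tail_term (R : realType) (beta s t : R) k : (0 < k)%N ->
  1 <= beta -> 0 <= s -> 0 <= t -> 2 * beta * t <= s ->
  beta * t ^+ k <= s ^+ k * 2^-1 ^+ k.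
Proof.
move=> k0 b1 s0 t0 h; have b0 : 0 <= beta := le_trans ler01 b1.
have -> : s ^+ k * 2^-1 ^+ k = (s * 2^-1) ^+ k by rewrite exprMn.
apply: le_trans (_ : (beta * t) ^+ k <= _); last first.
  by rewrite lerXn2r ?nnegrE ?mulr_ge0//; lra.
by rewrite exprMn ler_wpM2r ?exprn_ge0// ler_eXnr.
Qed.

Lemma predn_split n d : (n < d)%N -> d.-1 = (d - n.+1 + n)%N.
Proof. lia. Qed.

Section LocalEstimates.
Variables (R : realType) (F : fieldType) (v : F -> R).
Hypothesis hv : absolute_value v.
Variables (d : nat) (C : R) (x : 'rV[F]_2).
Hypothesis d0 : (0 < d)%N.
Implicit Types a : 'rV[F]_d.+1.
Local Notation s := (v (x 0 0)).
Local Notation t := (v (x 0 1)).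
Local Notation m := (norm_max v x).

Let s0 : 0 <= s. Proof. exact: absv_ge0. Qed.
Let t0 : 0 <= t. Proof. exact: absv_ge0. Qed.
Let sm : s <= m. Proof. exact: norm_max_ge. Qed.
Let tm : t <= m. Proof. exact: norm_max_ge. Qed.

Lemma form_term_le a (k : 'I_d.+1) : v (a 0 k) <= C ->
  v (a 0 k * x 0 0 ^+ (d - k) * x 0 1 ^+ k) <= C * m ^+ d.
Proof.
move=> aC; rewrite !(absvM hv) !(absvX hv) -mulrA ler_pM ?mulr_ge0 ?exprn_ge0 ?absv_ge0//.
have -> : m ^+ d = m ^+ (d - k) * m ^+ k by rewrite -exprD subnK// -ltnS.
by rewrite ler_pM ?exprn_ge0// lerXn2r ?nnegrE ?norm_max_ge0.
Qed.

Lemma form_eval_le a : (forall k, v (a 0 k) <= C) ->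
  v (form_eval a x) <= d.+1%:R * (C * m ^+ d).
Proof.
move=> aC; apply: le_trans (absv_sum hv _ _ _) _.
apply: le_trans (_ : \sum_(k < d.+1) C * m ^+ d <= _).
  by apply: ler_sum => k _; exact: form_term_le.
by rewrite sumr_const card_ord mulr_natl.
Qed.

Lemma form_eval_ultra_le a : (forall n : nat, v n%:R <= 1) ->
  (forall k, v (a 0 k) <= C) -> v (form_eval a x) <= C * m ^+ d.
Proof.
move=> vn aC; apply: absv_ultra_sum => // [|k _]; last exact: form_term_le.
by rewrite mulr_ge0 ?exprn_ge0 ?norm_max_ge0// (le_trans _ (aC 0)) ?absv_ge0.
Qed.

Variables (a : 'rV[F]_d.+1) (b : F) (M : R).
Hypothesis a00 : a 0 0 != 0.
Hypothesis b0 : b != 0.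
Hypothesis aC : forall k, v (a 0 k) <= C.
Hypothesis bC : v b <= C.
Local Notation B := (C / v (a 0 0)).

Let va : 0 < v (a 0 0). Proof. by rewrite absv_gt0. Qed.
Let vb : 0 < v b. Proof. by rewrite absv_gt0. Qed.
Let B1 : 1 <= B. Proof. by rewrite ler_pdivlMr// mul1r. Qed.
Let B0 : 0 < B. Proof. exact: lt_le_trans ltr01 B1. Qed.

Lemma form_eval_tail : form_eval a x = a 0 0 * x 0 0 ^+ d +
  \sum_(k < d) a 0 (lift ord0 k) * x 0 0 ^+ (d - k.+1) * x 0 1 ^+ k.+1.
Proof.
rewrite /form_eval big_ord_recl/= subn0 expr0 mulr1; congr (_ + _).
Qed.

(* With [B = C / v (a 0 0)], [kappa B] bounds the roots of [a]: if [s <= kappa B t], use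
   the second form [b X_1^d]; otherwise the leading term of [a] dominates. The factor
   [1 / (v (a 0 0) ^+ d * v b)] disappears from the product over all places. *)
Lemma norm_max_lower (kappa : R) : 1 <= kappa ->
  (kappa * B * t < s -> v (a 0 0) * s ^+ d <= kappa ^+ d * v (form_eval a x)) ->
  v (form_eval a x) <= M -> v (b * x 0 1 ^+ d) <= M ->
  m ^+ d <= kappa ^+ d * ((C / v (a 0 0)) ^+ d / v b) * M.
Proof.
move=> k1 dom F0M F1M; have k0 : 0 < kappa := lt_le_trans ltr01 k1.
have kB : 1 <= kappa * B by rewrite -[1]mulr1 ler_pM.
have kBt : 0 <= kappa * B * t by rewrite mulr_ge0// (le_trans ler01).
have [st|ts] := leP s (kappa * B * t).
  have mt : m <= kappa * B * t.
    apply: norm_max_le => // k.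
    case: (ord2P k) => -> //.
    by rewrite ler_peMl.
  apply: le_trans (_ : (kappa * B * t) ^+ d <= _).
    by rewrite lerXn2r ?nnegrE ?norm_max_ge0.
  have tM : t ^+ d <= (v b)^-1 * M by rewrite ler_pdivlMl// -(absvX hv) -(absvM hv).
  rewrite (exprMn d (kappa * B)) (exprMn d kappa) -!mulrA.
  by rewrite ler_wpM2l ?exprn_ge0 ?(ltW k0)// ler_wpM2l ?exprn_ge0 ?(ltW B0).
have ms : m <= s.
  apply: norm_max_le => // k.
  case: (ord2P k) => -> //.
  by apply: ltW; apply: le_lt_trans ts; rewrite ler_peMl.
apply: le_trans (_ : s ^+ d <= _); first by rewrite lerXn2r ?nnegrE ?norm_max_ge0.
have {}dom := le_trans (dom ts) (ler_wpM2l (exprn_ge0 d (ltW k0)) F0M).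
have M0 : 0 <= M := le_trans (absv_ge0 hv _) F0M.
(* This brings the second case to the constant of the first: [v b <= C = v (a 0 0) * B] and
   [B <= B ^+ d]. *)
have vBb : (v (a 0 0))^-1 <= B ^+ d / v b.
  rewrite ler_pdivlMr// ler_pdivrMl//; apply: le_trans bC _.
  apply: le_trans (_ : v (a 0 0) * B <= _); first by rewrite mulrC divfK// gt_eqF.
  by rewrite ler_wpM2l ?(ltW va)// ler_eXnr.
apply: le_trans (_ : (v (a 0 0))^-1 * (kappa ^+ d * M) <= _).
  by rewrite ler_pdivlMl.
rewrite mulrCA -[leRHS]mulrA ler_wpM2l ?exprn_ge0 ?(ltW k0)//.
by rewrite ler_wpM2r.
Qed.

(** The k-th term is at most [2 ^ -k] times the leading one. These weights sum to [1 - 2 ^ -d], so a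
    share [2 ^ -d] of the leading term survives: the origin of [2 ^+ d]. *)
Lemma form_eval_dominant : 2 * B * t < s -> v (a 0 0) * s ^+ d <= 2 ^+ d * v (form_eval a x).
Proof.
move=> ts.
pose T := \sum_(k < d) a 0 (lift ord0 k) * x 0 0 ^+ (d - k.+1) * x 0 1 ^+ k.+1.
have hT : v T <= v (a 0 0) * s ^+ d * (1 - 2^-1 ^+ d).
  apply: le_trans (absv_sum hv _ _ _) _.
  apply: le_trans (_ : \sum_(k < d) v (a 0 0) * s ^+ d * 2^-1 ^+ k.+1 <= _).
    apply: ler_sum => k _; rewrite !(absvM hv) !(absvX hv).
    have -> : s ^+ d = s ^+ (d - k.+1) * s ^+ k.+1 by rewrite -exprD subnK.
    apply: le_trans (_ : v (a 0 0) * B * s ^+ (d - k.+1) * t ^+ k.+1 <= _).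
      by rewrite !ler_wpM2r ?exprn_ge0// mulrC divfK ?gt_eqF.
    have := dominated_tail_term (ltn0Sn k) B1 s0 t0 (ltW ts) => h.
    have := ler_wpM2l (mulr_ge0 (ltW va) (exprn_ge0 (d - k.+1) s0)) h.
    by congr (_ <= _); ring.
  rewrite -mulr_sumr ler_wpM2l ?mulr_ge0 ?exprn_ge0 ?(ltW va)//.
  suff -> : \sum_(i < d) 2^-1 ^+ i.+1 = 1 - 2^-1 ^+ d :> R by [].
  elim: (d) => [|n IH]; first by rewrite big_ord0 expr0 subrr.
  rewrite big_ord_recr/= IH [in RHS]exprS exprS; lra.
have vF : v (a 0 0) * s ^+ d - v T <= v (form_eval a x).
  rewrite form_eval_tail -/T -(absvX hv) -(absvM hv); exact: absv_lerD.
have p2 : 0 < 2 ^+ d :> R by rewrite exprn_gt0.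
rewrite -ler_pdivrMl// -exprVn mulrC.
apply: le_trans vF; lra.
Qed.

(** The tail is strictly smaller than the leading term, so the ultrametric inequality loses nothing.
    The factors 1 match [norm_max_lower] at [kappa = 1]. *)
Lemma form_eval_ultra_dominant : (forall n : nat, v n%:R <= 1) ->
  1 * B * t < s -> v (a 0 0) * s ^+ d <= 1 ^+ d * v (form_eval a x).
Proof.
move=> vn; rewrite mul1r expr1n mul1r => ts.
have ts' : t <= s by apply: ltW; apply: le_lt_trans ts; rewrite ler_peMl.
pose T := \sum_(k < d) a 0 (lift ord0 k) * x 0 0 ^+ (d - k.+1) * x 0 1 ^+ k.+1.
have sp : 0 < s by apply: le_lt_trans ts; rewrite mulr_ge0// ltW.
have hT : v T <= C * t * s ^+ d.-1.
  have C0 : 0 <= C := le_trans (ltW vb) bC.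
  apply: absv_ultra_sum => // [|k _]; first by rewrite !mulr_ge0 ?exprn_ge0.
  rewrite !(absvM hv) !(absvX hv) -!mulrA ler_pM ?mulr_ge0 ?exprn_ge0 ?absv_ge0//.
  have -> : s ^+ d.-1 = s ^+ (d - k.+1) * s ^+ k.
    by rewrite -exprD -predn_split.
  rewrite mulrCA ler_wpM2l ?exprn_ge0// exprS ler_wpM2l//.
  by rewrite lerXn2r ?nnegrE.
have hT' : v T < v (a 0 0) * s ^+ d.
  have -> : s ^+ d = s * s ^+ d.-1 by rewrite -exprS prednK.
  apply: le_lt_trans hT _; rewrite mulrA ltr_pM2r ?exprn_gt0//.
  by rewrite -ltr_pdivrMl// mulrA [_^-1 * _]mulrC.
have : v (a 0 0 * x 0 0 ^+ d) <= Num.max (v (form_eval a x)) (v (- T)).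
  have -> : a 0 0 * x 0 0 ^+ d = form_eval a x + - T by rewrite form_eval_tail addrK.
  exact: absv_ultra.
rewrite (absvN hv) (absvM hv) (absvX hv) le_max => /orP[//|].
by rewrite leNgt hT'.
Qed.

End LocalEstimates.

(** * Height inequalities *)

Section FormImage.
Variables (F : fieldType) (d : nat) (A : 'M[F]_(2, d.+1)) (b : F) (X : 'rV[F]_2).

Definition form_image : 'rV[F]_2 := \row_i form_eval (row i A) X.

Hypothesis rowA1 : row 1 A = b *: delta_mx 0 ord_max.

Lemma form_eval_row1 : form_eval (row 1 A) X = b * X 0 1 ^+ d.
Proof.
rewrite rowA1 /form_eval (bigD1 ord_max)//= big1 => [|k /negbTE kd].
  by rewrite !mxE !eqxx mulr1 subnn expr0 mulr1 addr0.
by rewrite !mxE kd andbF mulr0 !mul0r.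
Qed.

Hypothesis d0 : (0 < d)%N.
Hypothesis b0 : b != 0.
Hypothesis A00 : A 0 0 != 0.
Variables (R : realType) (v : F -> R) (ultra : bool).
Hypothesis hv : absolute_value v.
Hypothesis vn : ultra -> forall n : nat, v n%:R <= 1.
Let C := norm_max v (mxvec A).

Lemma coef_norm_le i k : v (A i k) <= C.
Proof. by rewrite -(mxvecE A i k); exact: norm_max_ge. Qed.

Let aC i k : v (row i A 0 k) <= C. Proof. by rewrite mxE coef_norm_le. Qed.

Lemma last_coef : b = A 1 ord_max.
Proof. by have /rowP/(_ ord_max) := rowA1; rewrite !mxE !eqxx mulr1. Qed.

Lemma form_image_upper :
  norm_max v form_image <= (if ultra then 1 else d.+1%:R) * (C * norm_max v X ^+ d).
Proof.
have Cm : 0 <= C * norm_max v X ^+ d by rewrite mulr_ge0 ?exprn_ge0 ?norm_max_ge0.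
apply: norm_max_le => [|i]; first by rewrite mulr_ge0//; case: ifP.
rewrite mxE; case: ifP => [/vn un|_]; last exact: form_eval_le.
by rewrite mul1r; apply: form_eval_ultra_le.
Qed.

Lemma form_image_lower :
  norm_max v X ^+ d <= (if ultra then 1 else 2) ^+ d *
    ((C / v (A 0 0)) ^+ d / v b) * norm_max v form_image.
Proof.
have bC : v b <= C by rewrite last_coef coef_norm_le.
have E : A 0 0 = row 0 A 0 0 by rewrite mxE.
have a0 : (row 0 A) 0 0 != 0 by rewrite -E.
have F0M : v (form_eval (row 0 A) X) <= norm_max v form_image.
  by have := norm_max_ge v form_image 0; rewrite mxE.
have F1M : v (b * X 0 1 ^+ d) <= norm_max v form_image.
  by have := norm_max_ge v form_image 1; rewrite mxE form_eval_row1.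
rewrite E; apply: (norm_max_lower hv d0 a0 b0 (aC 0) bC _ _ F0M F1M).
  by case: ifP; rewrite ?ler1n.
case: ifP => [/vn un|_]; last exact: (form_eval_dominant hv a0 (aC 0)).
exact: (form_eval_ultra_dominant hv d0 a0 b0 (aC 0) bC un).
Qed.

End FormImage.

Section GlobalEstimates.
Variables (R : realType) (N : splittingFieldType rat) (w : option nat -> N -> R).
Local Notation G := (gal_of {:N}%VS).
Hypothesis hw : forall o, base_valid o -> absolute_value (w o).
Hypothesis wu : forall o, base_valid o -> forall q, w o (ratr q) = base_abs R o q.
Variables (d : nat) (A : 'M[N]_(2, d.+1)) (b : N).
Hypothesis rowA1 : row 1 A = b *: delta_mx 0 ord_max.
Hypothesis d0 : (0 < d)%N.
Hypothesis b0 : b != 0.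
Hypothesis A00 : A 0 0 != 0.
Variable X : 'rV[N]_2.

Lemma base_ultra o (g : G) : base_valid o -> isSome o -> forall n : nat, w o (g n%:R) <= 1.
Proof.
move=> vo so n; have -> : g n%:R = ratr n%:R by rewrite rmorph_nat ratr_in_alg rmorph_nat.
by rewrite (wu vo); case: o vo so => //= p pp _; exact: padic_abs_le1.
Qed.

Definition place_prod B (f : option nat -> G -> R) : R :=
  \prod_(o <- bases B) \prod_(g : G) f o g.

Lemma place_prodM B f h : place_prod B (fun o g => f o g * h o g) = place_prod B f * place_prod B h.
Proof. by rewrite /place_prod -big_split; apply: eq_bigr => o _; rewrite big_split. Qed.

Lemma place_prodV B f : place_prod B (fun o g => (f o g)^-1) = (place_prod B f)^-1.
Proof. by rewrite /place_prod -prodfV; apply: eq_bigr => o _; rewrite prodfV. Qed.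

Lemma place_prodX B f n : place_prod B (fun o g => f o g ^+ n) = place_prod B f ^+ n.
Proof. by rewrite /place_prod -prodrXl; apply: eq_bigr => o _; rewrite prodrXl. Qed.

Lemma place_prod_arch B (c : R) :
  place_prod B (fun o _ => if isSome o then 1 else c) = c ^+ #|{: G}|.
Proof.
rewrite /place_prod /bases big_cons big_map [X in _ * X]big1 ?mulr1 => [|p _]; last by rewrite big1.
by rewrite prodr_const.
Qed.

Lemma ler_place_prod B (f h : option nat -> G -> R) :
  (forall o g, base_valid o -> 0 <= f o g <= h o g) -> place_prod B f <= place_prod B h.
Proof.
move=> fh; rewrite /place_prod big_seq [leRHS]big_seq; apply: ler_prod => o /bases_valid vo.
rewrite prodr_ge0 => [|g _]; last by case/andP: (fh o g vo).
by apply: ler_prod => g _; exact: fh.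
Qed.

Lemma partial_height_upper B : partial_height w B (form_image A X) <=
  d.+1%:R ^+ #|{: G}| * (partial_height w B (mxvec A) * partial_height w B X ^+ d).
Proof.
rewrite -(place_prod_arch B) -place_prodX -!place_prodM.
apply: ler_place_prod => o g vo; rewrite norm_max_ge0/=.
exact: form_image_upper (absv_galQ (hw vo) g) (@base_ultra o g vo).
Qed.

Lemma partial_height_lower : exists B0, forall B, (B0 <= B)%N ->
  partial_height w B X ^+ d <= (2 ^+ #|{: G}|) ^+ d *
    partial_height w B (mxvec A) ^+ d * partial_height w B (form_image A X).
Proof.
have [B1 H1] := product_formula hw wu A00; have [B2 H2] := product_formula hw wu b0.
exists (maxn B1 B2) => B; rewrite geq_max => /andP[/H1 pA /H2 pb].
(* The inserted products are 1 by the product formula; they supply the local factors [v (A 0 0)] and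
   [v b] of [form_image_lower]. *)
have -> : partial_height w B (mxvec A) ^+ d =
  (partial_height w B (mxvec A) / place_prod B (fun o g => w o (g (A 0 0)))) ^+ d /
    place_prod B (fun o g => w o (g b)) by rewrite /place_prod pA pb !divr1.
rewrite -(place_prod_arch B) -!place_prodV -!place_prodX -!place_prodM.
rewrite -!place_prodX -!place_prodM.
apply: ler_place_prod => o g vo; rewrite exprn_ge0 ?norm_max_ge0//=.
exact: (form_image_lower X rowA1 d0 b0 A00 (absv_galQ (hw vo) g) (@base_ultra o g vo)).
Qed.

Lemma partial_height_coef_ge1 : exists B0, forall B, (B0 <= B)%N ->
  1 <= partial_height w B (mxvec A).
Proof.
have [B1 H1] := product_formula hw wu b0; exists B1 => B /H1 pb.
rewrite -pb; apply: (@ler_place_prod B (fun o g => w o (g b))) => o g vo.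
have hv := absv_galQ (hw vo) g.
rewrite (absv_ge0 hv b)/= (last_coef rowA1); exact: (coef_norm_le _ (fun a => w o (g a))).
Qed.

End GlobalEstimates.

Section HeightInequalities.
Variables (R : realType) (K : fieldExtType rat) (iota : {rmorphism K -> algC}) (d : nat).
Variable phi : ratmap iota d.
Hypothesis d0 : (0 < d)%N.
Hypothesis hphi : polynomial_map phi.

Lemma ratmap_eval_neq0 x : x != 0 -> ratmap_eval phi x != 0.
Proof.
move=> /(ratmap_no_common_zero phi)[i]; apply: contra_neq => /rowP/(_ i).
by rewrite !mxE.
Qed.

Lemma form_eval_map (F L : fieldType) (f : {rmorphism F -> L}) n (a : 'rV[F]_n.+1) (x : 'rV[F]_2) :
  form_eval (map_mx f a) (map_mx f x) = f (form_eval a x).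
Proof.
rewrite rmorph_sum/=; apply: eq_bigr => k _.
by rewrite !mxE !rmorphM/= !rmorphXn.
Qed.

Lemma ratmap_height_inequalities x : x != 0 ->
  [/\ height R (ratmap_eval phi x) <= ln d.+1%:R + (ratmap_height R phi + d%:R * height R x),
      d%:R * height R x <= d%:R * ln 2 + d%:R * ratmap_height R phi + height R (ratmap_eval phi x)
    & 0 <= ratmap_height R phi].
Proof.
move=> x0; have [c c0 hc] := hphi.
have [N [nu hN]] := splitting_field_containing
  ([seq iota b | b <- vbasis {:K}] ++ [seq x 0 i | i <- enum 'I_2]).
have [|j jE] := @lift_embedding K iota N nu.
  by move=> a ha; apply: hN; rewrite mem_cat ha.
have hX i : exists y, nu y = x 0 i.
  by apply: hN; rewrite mem_cat; apply/orP; right; apply: map_f; rewrite mem_enum.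
pose X : 'rV[N]_2 := \row_i projT1 (cid (hX i)).
have XE : map_mx nu X = x by apply/rowP => i; rewrite !mxE; case: cid.
have X0 : X != 0 by rewrite -(map_mx_neq0 nu) XE.
pose A := map_mx j (ratmap_coef phi).
have AE : map_mx nu A = map_mx iota (ratmap_coef phi).
  by apply/matrixP => i k; rewrite !mxE jE.
have rowA1 : row 1 A = j c^-1 *: delta_mx 0 ord_max.
  rewrite /A -map_row; have -> : row 1 (ratmap_coef phi) = c^-1 *: delta_mx 0 ord_max.
    by rewrite -hc scalerA mulVf// scale1r.
  by rewrite map_mxZ map_delta_mx.
have b0 : j c^-1 != 0 by rewrite fmorph_eq0 invr_eq0.
have FE : map_mx nu (form_image A X) = ratmap_eval phi x.
  apply/rowP => i; rewrite !mxE -form_eval_map XE; congr form_eval.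
  by rewrite map_row AE map_row.
(* At the point [(1 : 0)] the second form vanishes because [d > 0], so the first does not; its value
   there is the leading coefficient. *)
have A00 : A 0 0 != 0.
  have e0 : delta_mx 0 0 != 0 :> 'rV[algC]_2.
    by apply/rV0Pn; exists 0; rewrite mxE !eqxx oner_neq0.
  have [i] := ratmap_no_common_zero phi e0.
  have ev : form_eval (map_mx iota (row i (ratmap_coef phi))) (delta_mx 0 0) = nu (A i 0).
    rewrite /form_eval big_ord_recl big1 => [|k _].
      by rewrite subn0 expr0 mulr1 !mxE !eqxx expr1n mulr1 addr0 jE.
    by rewrite [X in _ * X ^+ _]mxE expr0n mulr0.
  rewrite ev fmorph_eq0; case: (ord2P i) => -> //.
  have -> : A 1 0 = 0; last by rewrite eqxx.
  have /rowP/(_ 0) := rowA1; rewrite !mxE eqxx /= => ->.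
  by case: (d) d0 => //= n _; rewrite mulr0.
have [w [hw wu]] := extended_absv_exists R N.
pose g := #|{: gal_of {:N}%VS}|.
have g0 : 0 < g%:R :> R by rewrite ltr0n; apply/card_gt0P; exists 1%g.
have F0 : form_image A X != 0 by rewrite -(map_mx_neq0 nu) FE ratmap_eval_neq0.
have A0 : mxvec A != 0.
  by rewrite mxvec_eq0; apply: contra_neq A00 => ->; rewrite mxE.
have [B1 H1] := height_formula nu hw wu X0.
have [B2 H2] := height_formula nu hw wu F0.
have [B3 H3] := height_formula nu hw wu A0.
have [B4 H4] := partial_height_lower hw wu rowA1 d0 b0 A00 X.
have [B5 H5] := partial_height_coef_ge1 hw wu rowA1 b0.
pose B := maxn (maxn B1 B2) (maxn B3 (maxn B4 B5)).
have {}H1 := H1 B ltac:(rewrite /B; lia); have {}H2 := H2 B ltac:(rewrite /B; lia).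
have {}H3 := H3 B ltac:(rewrite /B; lia); have {}H4 := H4 B ltac:(rewrite /B; lia).
have {}H5 := H5 B ltac:(rewrite /B; lia).
rewrite XE in H1; rewrite FE in H2; rewrite map_mxvec AE -map_mxvec in H3.
rewrite -/g in H1 H2 H3 H4.
have pX := partial_height_gt0 hw B X0; have pF := partial_height_gt0 hw B F0.
have pA := partial_height_gt0 hw B A0.
have U := partial_height_upper hw wu A X B; rewrite -/g in U.
rewrite -/(ratmap_height R phi) in H3.
have P2 : 0 < 2 ^+ g :> R by rewrite exprn_gt0.
have Pd : 0 < d.+1%:R ^+ g :> R by rewrite exprn_gt0.
split.
- rewrite -(ler_pM2l g0) !mulrDr mulrCA H1 H2 H3.
  move: U; rewrite -ler_ln ?posrE ?mulr_gt0 ?exprn_gt0//.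
  rewrite !lnM ?posrE ?mulr_gt0 ?exprn_gt0// !lnXn//.
  by rewrite !mulr_natl.
- rewrite -(ler_pM2l g0) !mulrDr mulrCA H1 mulrCA [_ * (d%:R * ratmap_height _ _)]mulrCA H2 H3.
  move: H4; rewrite -ler_ln ?posrE ?mulr_gt0 ?exprn_gt0//.
  rewrite !lnM ?posrE ?mulr_gt0 ?exprn_gt0// !lnXn ?exprn_gt0//.
  by rewrite !mulr_natl.
- by rewrite -(pmulr_rge0 _ g0) H3 ln_ge0.
Qed.

End HeightInequalities.

(** The steps are dominated by a geometric series with sum [c / (r - 1)]. Convergence is proved on
    the way, as [limn] carries information only for convergent sequences. *)
Lemma telescoping_limit (R : realType) (a : nat -> R) (c r : R) :
  0 <= c -> 1 < r -> (forall n, `|a n.+1 - a n| <= c / r ^+ n.+1) ->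
  `|limn a - a 0%N| <= c / (r - 1).
Proof.
move=> c0 r1 ha; have r0 : 0 < r := lt_trans ltr01 r1.
have r10 : 0 < r - 1 by rewrite subr_gt0.
have step m k : `|a (m + k)%N - a m| <= c / (r - 1) * (r^-1 ^+ m - r^-1 ^+ (m + k)).
  elim: k => [|k IH]; first by rewrite addn0 !subrr normr0 mulr0.
  rewrite addnS -(subrK (a (m + k)%N) (a (m + k).+1)) -addrA.
  apply: le_trans (ler_normD _ _) _; apply: le_trans (lerD (ha _) IH) _.
  rewrite -exprVn exprS le_eqVlt; apply/orP; left; apply/eqP.
  by field; rewrite !gt_eqF.
have C0 : 0 <= c / (r - 1) by rewrite divr_ge0// ltW.
have step_le m k : `|a (m + k)%N - a m| <= c / (r - 1) * r^-1 ^+ m.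
  apply: le_trans (step m k) _; rewrite ler_wpM2l// gerBl exprn_ge0//.
  by rewrite invr_ge0 ltW.
have acvg : cvg (a @ \oo)%classic.
  apply: real_cauchy_cvg => e e0.
  have e2 : 0 < e / 2 / (c / (r - 1) + 1) by rewrite !divr_gt0// ltr_wpDl.
  have [|N HN] := @exprn_small _ r^-1 _ _ e2; first by rewrite invr_ge0 (ltW r0) invf_lt1.
  have near_N n : (N <= n)%N -> `|a n - a N| < e / 2.
    move=> Nn; rewrite -(subnKC Nn); apply: le_lt_trans (step_le _ _) _.
    have := HN N (leqnn _); rewrite ltr_pdivlMr ?ltr_wpDl//; apply: le_lt_trans.
    by rewrite mulrC ler_wpM2l ?exprn_ge0 ?invr_ge0 ?(ltW r0)// lerDl.
  exists N => m n /near_N hm /near_N hn.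
  rewrite -(subrK (a N) (a m)) -addrA; apply: le_lt_trans (ler_normD _ _) _.
  rewrite [`|a N - a n|]distrC; lra.
rewrite ler_distl; apply/andP; split.
  apply: limr_ge => //; exists 0%N => // n _ /=.
  by have := step_le 0%N n; rewrite add0n expr0 mulr1 ler_distl => /andP[].
apply: limr_le => //; exists 0%N => // n _ /=.
by have := step_le 0%N n; rewrite add0n expr0 mulr1 ler_distl => /andP[].
Qed.

Theorem theorem1p3 (R : realType) (K : fieldExtType rat)
    (iota : {rmorphism K -> algC}) (d : nat) (hd : (2 <= d)%N)
    (phi : ratmap iota d) (hphi : polynomial_map phi)
    (x : 'rV[algC]_2) (hx : x != 0) :
  `|canonical_height R phi x - height R x|
    <= d%:R / (d%:R - 1) * (ln 2 + ln d%:R / d%:R + ratmap_height R phi).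
Proof.
have d0 : (0 < d)%N by apply: leq_trans hd.
have d1 : 1 < d%:R :> R by rewrite ltr1n.
have dp : 0 < d%:R :> R by rewrite ltr0n.
pose y n := iter n (ratmap_eval phi) x.
have y0 n : y n != 0 by elim: n => //= n IH; exact: ratmap_eval_neq0.
have [_ _ hphi0] := ratmap_height_inequalities R d0 hphi hx.
have ln2 : 0 <= ln 2 :> R by rewrite ln_ge0// ler1n.
pose c : R := d%:R * (ln 2 + ratmap_height R phi).
have c0 : 0 <= c by rewrite mulr_ge0 ?addr_ge0// ltW.
(* From [d + 1 <= 2 ^ d]; this fits the upper estimate to the constant [c] of the lower one. *)
have lnd : ln d.+1%:R <= d%:R * ln 2 :> R.
  rewrite mulr_natl -lnXn// ler_ln ?posrE ?exprn_gt0//.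
  by rewrite -natrX ler_nat ltn_expl.
have step n : `|height R (y n.+1) / d%:R ^+ n.+1 - height R (y n) / d%:R ^+ n|
    <= c / d%:R ^+ n.+1.
  have [up low _] := ratmap_height_inequalities R d0 hphi (y0 n).
  have -> : height R (y n.+1) / d%:R ^+ n.+1 - height R (y n) / d%:R ^+ n =
      (height R (y n.+1) - d%:R * height R (y n)) / d%:R ^+ n.+1.
    by rewrite exprS; field; rewrite expf_neq0 gt_eqF.
  rewrite normrM [`|_^-1|]ger0_norm ?invr_ge0 ?exprn_ge0//.
  rewrite ler_wpM2r ?invr_ge0 ?exprn_ge0// ler_norml /c.
  (* The upper estimate has [h(phi)] once, the lower one [d] times; as [h(phi) >= 0], the larger
     serves both. *)
  have : ratmap_height R phi <= d%:R * ratmap_height R phi by rewrite ler_peMl// ltW.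
  rewrite [y n.+1]/=; move: up low lnd; rewrite -/(y n) mulrDr.
  set a := height R _; set b := d%:R * height R _; set h := d%:R * ratmap_height R phi.
  by move=> *; apply/andP; split; lra.
have := telescoping_limit c0 d1 step; rewrite expr0 divr1 => /le_trans; apply.
rewrite /c mulrAC; apply: ler_wpM2l; first by rewrite divr_ge0// ltW// subr_gt0.
by rewrite lerD2r lerDl divr_ge0 ?ln_ge0 ?ler1n// ltW.
Qed.
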